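(* Let $k\ge0$, $p,q\in\mathbb N_0$, $\mu\in\mathbb C^p$, $\nu\in\mathbb C^q$ with $\nu_i\notin\{0,k,\dots,k(n-1)\}-\mathbb N_0$ for all $i=1,\dots,q$ (so $[\nu]_\lambda\ne0$ for all $\lambda\in\Lambda_n^+$). (1) If $p\le q$, the series ${}_pK_q(\mu;\nu;\cdot,\cdot)$ and ${}_pF_q(\mu;\nu;\cdot,\cdot)$ define entire functions on $\mathbb C^n\times\mathbb C^n$. (2) If $p=q+1$, they define holomorphic functions on $\{(z,w)\in\mathbb C^n\times\mathbb C^n:\|z\|_\infty\|w\|_\infty<1\}$. Moreover, these series are holomorphic in the parameters $(\mu,\nu)$ on $\{(\mu,\nu)\in\mathbb C^p\times\mathbb C^q:\nu_i\notin\{0,k,\dots,k(n-1)\}-\mathbb N_0\text{ for all }i\}$.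
   Context: $s_{ij}$ transposition of coordinates; Dunkl operators $T_\xi f(x)=\partial_\xi f(x)+k\sum_{i<j}(\xi_i-\xi_j)\frac{f(x)-f(s_{ij}x)}{x_i-x_j}$, $T_j=T_{e_j}$; $\underline1=(1,\dots,1)$; $[\mu]_\eta=\prod_{j=1}^n(\mu-k(j-1))_{\eta_j}$ (Pochhammer symbols). Jack polynomials: $\Lambda_n^+$ partitions of length $\le n$; $\eta_+$ decreasing rearrangement, $|\eta|=\sum\eta_i$. Order $\prec$ on $\mathbb N_0^n$: $\kappa\prec\eta$ iff $\kappa_+$ strictly below $\eta_+$ in dominance order (same weight, partial sums $\le$), or $\kappa_+=\eta_+$ and $w_\eta<w_\kappa$ in Bruhat order ($w_\eta$ shortest permutation with $w_\eta\eta_+=\eta$). With $\mathcal D_j=x_jT_j+k(1-n)+k\sum_{i>j}s_{ij}$, $\overline\eta_j=\eta_j-k\#\{i<j:\eta_i\ge\eta_j\}-k\#\{i>j:\eta_i>\eta_j\}$, $E_\eta$ is the unique polynomial $x^\eta+\sum_{\kappa\prec\eta}c_{\eta\kappa}x^\kappa$ with $\mathcal D_jE_\eta=\overline\eta_jE_\eta$. Let $c_\eta$ be the unique scalars with $(z_1+\dots+z_n)^m=\sum_{|\eta|=m}c_\eta E_\eta(z)$ for all $m$ (positive), $L_\eta=c_\eta E_\eta$, $C_\lambda=\sum_{\eta\in\mathcal S_n\lambda}L_\eta$ (distinct rearrangements). Hypergeometric series: $[\mu]_\lambda=\prod_{i=1}^p[\mu_i]_\lambda$, $[\nu]_\lambda=\prod_{i=1}^q[\nu_i]_\lambda$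 (empty product $1$); ${}_pK_q(\mu;\nu;z,w)=\sum_{\eta\in\mathbb N_0^n}\frac{[\mu]_{\eta_+}}{[\nu]_{\eta_+}}\frac{L_\eta(z)L_\eta(w)}{|\eta|!L_\eta(\underline1)}$, ${}_pF_q(\mu;\nu;z,w)=\sum_{\lambda\in\Lambda_n^+}\frac{[\mu]_\lambda}{[\nu]_\lambda}\frac{C_\lambda(z)C_\lambda(w)}{|\lambda|!C_\lambda(\underline1)}$. *)

(* Defs.v *)
From HB Require Import structures.
From mathcomp Require Import all_boot all_order all_algebra all_fingroup.
From mathcomp Require Import all_classical all_reals all_analysis.
From mathcomp Require Import complex.
From mathcomp Require mpoly.
Import (canonicals, hints, coercions) mpoly.

Set Implicit Arguments.
Unset Strict Implicit.
Unset Printing Implicit Defensive.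

Import Order.TTheory GRing.Theory Num.Theory.
Local Open Scope classical_set_scope.
Local Open Scope ring_scope.

Section Jack.
Variables (R : realType) (n : nat) (k : R).

Local Notation C := (R[i]).
Local Notation kC := (real_complex R k).
Local Notation P := (mpoly.mpoly n C).
Local Notation mnm := (mpoly.multinom n).

Definition Xv (j : 'I_n) : P := @mpoly.mpolyX n C (mpoly.mnm1 j).

Definition sij (i j : 'I_n) (f : P) : P := mpoly.msym (tperm i j) f.

Definition ddiff (i j : 'I_n) (f : P) : P :=
  if pselect (exists g : P, (Xv i - Xv j) * g = f - sij i j f) is left h
  then projT1 (cid h) else 0.

Definition dunkl (xi : 'I_n -> C) (f : P) : P :=
  \sum_(j < n) xi j *: mpoly.mderiv j f
  + kC *: \sum_(i < n) \sum_(j < n | (i < j)%N) (xi i - xi j) *: ddiff i j f.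

Definition dunklj (j : 'I_n) : P -> P := dunkl (fun l => (l == j)%:R).

Definition Dop (j : 'I_n) (f : P) : P :=
  Xv j * dunklj j f + (kC * (1 - n%:R)) *: f
  + kC *: \sum_(i < n | (j < i)%N) sij i j f.

Definition ebar (eta : mnm) (j : 'I_n) : C :=
  (eta j)%:R
  - kC * (#|[set i : 'I_n | (i < j)%N && (eta j <= eta i)%N]|)%:R
  - kC * (#|[set i : 'I_n | (j < i)%N && (eta j < eta i)%N]|)%:R.

Definition eplus (eta : mnm) : mnm :=
  mpoly.Multinom (sort_tuple geq (mpoly.multinom_val eta)).

Definition is_partition (eta : mnm) : bool := eplus eta == eta.

Definition dom_le (a b : mnm) : bool :=
  (mpoly.mdeg a == mpoly.mdeg b) &&
  [forall l : 'I_n.+1, (\sum_(i < n | (i < l)%N) a i <= \sum_(i < n | (i < l)%N) b i)%N].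

Definition pact (w : 'S_n) (eta : mnm) : mnm :=
  mpoly.Multinom [tuple (eta ((w^-1)%g i) : nat) | i < n].

Definition plen (w : 'S_n) : nat :=
  #|[set x : 'I_n * 'I_n | (x.1 < x.2)%N && (w x.2 < w x.1)%N]|.

Definition weta (eta : mnm) : 'S_n :=
  [arg min_(w < 1%g | pact w (eplus eta) == eta) plen w].

Definition bruhat_step (v w : 'S_n) : bool :=
  [exists t1 : 'I_n, exists t2 : 'I_n,
     [&& t1 != t2, w == (v * tperm t1 t2)%g & (plen v < plen w)%N]].

Definition bruhat_lt (v w : 'S_n) : bool := (v != w) && connect bruhat_step v w.

Definition prec (kappa eta : mnm) : bool :=
  (dom_le (eplus kappa) (eplus eta) && (eplus kappa != eplus eta))
  || ((eplus kappa == eplus eta) && bruhat_lt (weta eta) (weta kappa)).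

Definition isE (eta : mnm) (p : P) : Prop :=
  [/\ mpoly.mcoeff eta p = 1,
      (forall kappa, kappa != eta -> ~~ prec kappa eta -> mpoly.mcoeff kappa p = 0)
    & (forall j, Dop j p = ebar eta j *: p)].

Definition Ejack (eta : mnm) : P :=
  if pselect (exists p, isE eta p) is left h then projT1 (cid h) else 0.

Definition isc (c : mnm -> C) : Prop :=
  forall (m : nat) (z : 'I_n -> C),
    (\sum_(i < n) z i) ^+ m =
    \sum_(eta : mpoly.bmultinom n m.+1 | mpoly.mdeg eta == m)
       c eta * mpoly.meval z (Ejack eta).

Definition cjack : mnm -> C :=
  if pselect (exists c, isc c) is left h then projT1 (cid h) else fun _ => 0.

Definition Ljack (eta : mnm) : P := cjack eta *: Ejack eta.

Definition Cjack (lam : mnm) : P :=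
  \sum_(eta : mpoly.bmultinom n (mpoly.mdeg lam).+1 | eplus eta == lam) Ljack eta.

Definition poch (a : C) (m : nat) : C := \prod_(l < m) (a + l%:R).

Definition gpoch (a : C) (eta : mnm) : C :=
  \prod_(j < n) poch (a - kC * j%:R) (eta j).

Definition gpochs (p : nat) (a : 'I_p -> C) (eta : mnm) : C :=
  \prod_(i < p) gpoch (a i) eta.

Definition one_vec : 'I_n -> C := fun _ => 1.

Definition Kterm (p q : nat) (mu : 'I_p -> C) (nu : 'I_q -> C)
    (z w : 'I_n -> C) (eta : mnm) : C :=
  gpochs mu (eplus eta) / gpochs nu (eplus eta)
  * (mpoly.meval z (Ljack eta) * mpoly.meval w (Ljack eta))
  / ((mpoly.mdeg eta)`!%:R * mpoly.meval one_vec (Ljack eta)).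

Definition Fterm (p q : nat) (mu : 'I_p -> C) (nu : 'I_q -> C)
    (z w : 'I_n -> C) (lam : mnm) : C :=
  if is_partition lam then
    gpochs mu lam / gpochs nu lam
    * (mpoly.meval z (Cjack lam) * mpoly.meval w (Cjack lam))
    / ((mpoly.mdeg lam)`!%:R * mpoly.meval one_vec (Cjack lam))
  else 0.

Definition psum (t : mnm -> C) (M : nat) : C^o :=
  \sum_(eta : mpoly.bmultinom n M) t eta.

Definition abs_summable (t : mnm -> C) : Prop :=
  cvg (psum (fun eta => `|t eta|) @ \oo).

Definition series_val (t : mnm -> C) : C := lim (psum t @ \oo).

End Jack.

Section Holo.
Variables (R : realType).
Local Notation C := (R[i]).

Definition supnorm (N : nat) (z : 'I_N -> C) : R :=
  \big[Num.max/0]_(i < N) Normc.normc (z i).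

(* f is holomorphic on (the open set) U: continuous on U and complex
   differentiable in each variable separately at every point of U *)
Definition holo_on (N : nat) (U : set ('I_N -> C)) (f : ('I_N -> C) -> C) : Prop :=
  (forall x, U x -> forall e : R, 0 < e -> exists2 d : R, 0 < d &
     forall y, U y -> (forall i, Normc.normc (y i - x i) < d) ->
       Normc.normc (f y - f x) < e)
  /\ (forall x, U x -> forall i : 'I_N,
        derivable (fun t : C^o => (f (fun l => if l == i then t else x l) : C^o))
                  (x i : C^o) 1).

Definition vleft (a b : nat) (v : 'I_(a + b) -> C) : 'I_a -> C :=
  fun i => v (lshift b i).
Definition vright (a b : nat) (v : 'I_(a + b) -> C) : 'I_b -> C :=
  fun i => v (rshift a i).

End Holo.

(* Main.v *)
(* Let [L eta] be the normalized nonsymmetric Jack polynomials. They are joint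
   eigenvectors of the Cherednik operators [D j] and sum up, in each degree, to a power
   of [x_1 + .. + x_n]; nothing else about them is used. Joint eigenspaces can be read
   off from any identity between sums of eigenvectors. Applied to the invariance of
   [(x_1 + .. + x_n) ^ m] under adjacent transpositions and to its derivative by [x_n],
   this gives the Knop-Sahi recursions for [L eta] with nonnegative factors, so that
   [L eta] is homogeneous with nonnegative coefficients, whence
   |L eta (z)| <= L eta (1, .., 1) * ||z|| ^ |eta|.
   The same recursions show that the symmetric polynomial
   [H_m = \sum_(|eta| = m) [a]_(eta+) L eta] satisfies [H_m (1, .., 1) = (n a)_m], and for
   [a = k n + 1] the quotients [mu]_lambda / [nu]_lambda are at most
   A rho ^ |lambda| [a]_lambda with any [rho > 0] if [p <= q], any [rho > 1] if [p = q + 1].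
   The part of degree [m] of the series is therefore bounded by
   A (rho ||z|| ||w||) ^ m (n a)_m / m!, a summable majorant. Holomorphy follows by
   summing first-order Taylor expansions with quadratic remainder, whose bound [jet] is
   submultiplicative and explicit for [1 / (nu + c)], in (z, w) and in (mu, nu) alike. *)

Require Import Defs.
From HB Require Import structures.
From mathcomp Require Import all_boot all_order all_algebra all_fingroup.
From mathcomp Require Import all_classical all_reals all_analysis.
From mathcomp Require Import complex ring lra zify.
From mathcomp Require mpoly.
Import (canonicals, hints, coercions) mpoly.
Set Implicit Arguments.
Unset Strict Implicit.
Unset Printing Implicit Defensive.
Import Order.TTheory GRing.Theory Num.Theory.
Local Open Scope classical_set_scope.
Local Open Scope ring_scope.

(** [Ejack] and [cjack] are chosen with default [0], so neither existence nor positivity can be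
    taken for granted. A dichotomy replaces them: either every [L eta] vanishes and both series are
    zero, or the eigenvalue equations and the sum identity hold. These suffice to isolate a single
    [L eta], because for [k >= 0] a composition is determined by its spectrum.

    The parameter [a = k n + 1] makes every factor [a - k j + l] with [j < n] at least [l + 1], so
    [[a]_lambda] dominates the product of the factorials of the parts. This product absorbs
    [[mu]_lambda / [nu]_lambda], whose factor at column [l] grows like [l ^ (p - q)] and is compared
    with [rho (l + 1)]. What remains, [(n a)_m / m!], grows only polynomially in [m].

    The terms are products whose number of factors grows with the degree. The analytic bound
    therefore has to be multiplicative without loss, on a polydisc that is the same for all degrees;
    this is why jets are used. *)

Lemma leibniz_difference (A : comNzRingType) (d f g sf sg f' g' : A) :
  d * f' = f - sf -> d * g' = g - sg -> d * (f * g' + f' * sg) = f * g - sf * sg.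
Proof. by move=> ef eg; rewrite mulrDr mulrCA eg mulrA ef; ring. Qed.

Lemma linear_sum_of (F : nzRingType) (U V : lmodType F) (h : U -> V) (I : Type)
    (r : seq I) (Q : pred I) (f : I -> U) :
  (forall a x y, h (a *: x + y) = a *: h x + h y) ->
  h (\sum_(i <- r | Q i) f i) = \sum_(i <- r | Q i) h (f i).
Proof.
move=> hl; have h0 : h 0 = 0.
  by have := hl (-1) 0 0; rewrite !scaleN1r oppr0 addr0 addNr.
apply: (@big_morph _ _ h 0 +%R 0 +%R _ h0) => x y.
by have := hl 1 x y; rewrite !scale1r.
Qed.

(* All that the calculus of Dunkl operators uses about polynomials: [X i] are the
   variables, [act] the permutations of variables, [der] the partial derivatives and
   [dd] the divided differences. *)
Record dunkl_calculus (F : fieldType) (A : comAlgType F) (n : nat)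
    (X : 'I_n -> A) (act : 'S_n -> A -> A) (der : 'I_n -> A -> A)
    (dd : 'I_n -> 'I_n -> A -> A) : Prop := DunklCalculus {
  act_linear : forall s a f g, act s (a *: f + g) = a *: act s f + act s g;
  actM : forall s f g, act s (f * g) = act s f * act s g;
  actMm : forall s t f, act (s * t)%g f = act t (act s f);
  act1m : forall f, act 1%g f = f;
  actX : forall s i, act s (X i) = X (s i);
  der_linear : forall l a f g, der l (a *: f + g) = a *: der l f + der l g;
  derM : forall l f g, der l (f * g) = der l f * g + f * der l g;
  derX : forall l i, der l (X i) = (l == i)%:R;
  act_der : forall s l f, act s (der l f) = der (s l) (act s f);
  subX_reg : forall i j f g, i != j -> (X i - X j) * f = (X i - X j) * g -> f = g;
  ddP : forall i j f, (X i - X j) * dd i j f = f - act (tperm i j) f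
}.

(** * Dunkl and Cherednik operators and their commutation relations *)

Section DunklCalculus.
Variables (F : fieldType) (A : comAlgType F) (n : nat) (K : F).
Variables (X : 'I_n -> A) (act : 'S_n -> A -> A) (der : 'I_n -> A -> A).
Variable dd : 'I_n -> 'I_n -> A -> A.
Hypothesis H : dunkl_calculus X act der dd.

(** Direction [e_l]: in the sum over pairs [i < j] only the pairs containing [l] survive, and the
    antisymmetry of the divided difference merges the cases [l = i] and [l = j]. *)
Definition dunkl_gen (l : 'I_n) (f : A) : A :=
  der l f + K *: \sum_(i | i != l) dd l i f.

Definition cherednik_gen (j : 'I_n) (f : A) : A :=
  X j * dunkl_gen j f + (K * (1 - n%:R)) *: f
  + K *: \sum_(i < n | (j < i)%N) act (tperm j i) f.

Local Notation T := dunkl_gen.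
Local Notation D := cherednik_gen.

Lemma act0 s : act s 0 = 0.
Proof. by have := act_linear H s (-1) 0 0; rewrite !scaleN1r oppr0 addr0 addNr. Qed.

Lemma actD s f g : act s (f + g) = act s f + act s g.
Proof. by have := act_linear H s 1 f g; rewrite !scale1r. Qed.

Lemma actZ s a f : act s (a *: f) = a *: act s f.
Proof. by have := act_linear H s a f 0; rewrite !addr0 act0 addr0. Qed.

Lemma actN s f : act s (- f) = - act s f.
Proof. by rewrite -scaleN1r actZ scaleN1r. Qed.

Lemma act_sum s (I : Type) (r : seq I) (Q : pred I) (f : I -> A) :
  act s (\sum_(i <- r | Q i) f i) = \sum_(i <- r | Q i) act s (f i).
Proof. exact: (linear_sum_of _ _ _ (act_linear H s)). Qed.

Lemma act_tpermK i j f : act (tperm i j) (act (tperm i j) f) = f.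
Proof. by rewrite -(actMm H) tperm2 (act1m H). Qed.

Lemma act_tperm s i j f :
  act s (act (tperm i j) f) = act (tperm (s i) (s j)) (act s f).
Proof.
by rewrite -!(actMm H) -tpermJ /conjg !mulgA mulgV mul1g.
Qed.

(** Quotients by [X i - X j] are unique, so a divided difference is computed by exhibiting a
    candidate. *)
Lemma dd_eq i j f g : i != j ->
  (X i - X j) * g = f - act (tperm i j) f -> dd i j f = g.
Proof. by move=> ij e; apply: (subX_reg H ij); rewrite (ddP H). Qed.

Lemma ddM i j f g : i != j ->
  dd i j (f * g) = f * dd i j g + dd i j f * act (tperm i j) g.
Proof.
move=> ij; apply: dd_eq => //.
by rewrite (leibniz_difference (ddP H i j f) (ddP H i j g)) (actM H).
Qed.

Lemma dd_linear i j a f g : i != j ->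
  dd i j (a *: f + g) = a *: dd i j f + dd i j g.
Proof.
move=> ij; apply: dd_eq => //.
by rewrite mulrDr -scalerAr !(ddP H) (act_linear H) scalerBr opprD addrACA.
Qed.

Lemma dd_Xl i j : i != j -> dd i j (X i) = 1.
Proof. by move=> ij; apply: dd_eq => //; rewrite mulr1 (actX H) tpermL. Qed.

Lemma dd_Xr i j : i != j -> dd i j (X j) = -1.
Proof. by move=> ij; apply: dd_eq => //; rewrite mulrN1 opprB (actX H) tpermR. Qed.

Lemma dd_X0 i j l : i != j -> i != l -> j != l -> dd i j (X l) = 0.
Proof.
by move=> ij li lj; apply: dd_eq => //; rewrite mulr0 (actX H) tpermD // subrr.
Qed.

Lemma act_dd s i j f : i != j ->
  act s (dd i j f) = dd (s i) (s j) (act s f).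
Proof.
move=> ij; apply/esym/dd_eq; first by rewrite (inj_eq perm_inj).
by rewrite -!(actX H) -actN -actD -(actM H) (ddP H) actD actN act_tperm.
Qed.

Lemma dunkl_gen_linear l a f g : T l (a *: f + g) = a *: T l f + T l g.
Proof.
rewrite /dunkl_gen (der_linear H).
rewrite (eq_bigr (fun i => a *: dd l i f + dd l i g)); last first.
  by move=> i il; rewrite dd_linear // eq_sym.
by rewrite big_split /= -scaler_sumr !scalerDr !scalerA [a * K]mulrC addrACA.
Qed.

Lemma act_dunkl s l f : act s (T l f) = T (s l) (act s f).
Proof.
rewrite /dunkl_gen actD actZ (act_der H) act_sum.
congr (_ + _ *: _); rewrite [RHS](reindex_inj (@perm_inj _ s)) /=.
apply: eq_big => [i|i il]; first by rewrite (inj_eq perm_inj).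
by rewrite act_dd // eq_sym.
Qed.

(** With [dunklMX_eq], the relations of the rational Cherednik algebra. Among the differences
    [dd l j] only the one with [j = i] sees [X i], with value [-1]. *)
Lemma dunklMX_neq l i f : i != l ->
  T l (X i * f) = X i * T l f - K *: act (tperm i l) f.
Proof.
move=> il; have li : l != i by rewrite eq_sym.
rewrite /dunkl_gen (derM H) (derX H) (negPf li) mul0r add0r.
rewrite (bigD1 i) //= [in RHS](bigD1 i) //= ddM // dd_Xr // mulN1r tpermC.
rewrite (eq_bigr (fun j => X i * dd l j f)) => [|j /andP[jl ji]]; last first.
  have lj : l != j by rewrite eq_sym.
  by rewrite ddM // (dd_X0 lj li ji) mul0r addr0.
rewrite -mulr_sumr mulrDr -scalerAr mulrDr !scalerDr scalerN.
by rewrite addrAC !addrA -!addrA; congr (_ + (_ + _)); rewrite addrC.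
Qed.

Lemma dunklMX_eq l f :
  T l (X l * f) = X l * T l f + f + K *: \sum_(i | i != l) act (tperm i l) f.
Proof.
rewrite /dunkl_gen (derM H) (derX H) eqxx mul1r.
rewrite (eq_bigr (fun j => X l * dd l j f + act (tperm j l) f)) => [|j jl]; last first.
  by rewrite ddM 1?eq_sym // dd_Xl 1?eq_sym // mul1r tpermC.
rewrite big_split /= -mulr_sumr mulrDr -scalerAr scalerDr.
by rewrite addrA; congr (_ + _); rewrite -addrA addrC.
Qed.

Lemma dunkl_sym l f : (forall i, act (tperm l i) f = f) -> T l f = der l f.
Proof.
move=> fs; rewrite /dunkl_gen big1 ?scaler0 ?addr0 // => i il.
by apply: dd_eq; rewrite 1?eq_sym // mulr0 fs subrr.
Qed.

Lemma cherednik_linear j a f g : D j (a *: f + g) = a *: D j f + D j g.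
Proof.
rewrite /cherednik_gen dunkl_gen_linear mulrDr -scalerAr.
rewrite (eq_bigr (fun i => a *: act (tperm j i) f + act (tperm j i) g)); last first.
  by move=> i _; rewrite (act_linear H).
rewrite big_split /= -scaler_sumr !scalerDr !scalerA [a * (K * _)]mulrC [a * K]mulrC.
set x1 := _ *: _; set x2 := X j * T j g.
by rewrite [x1 + x2 + _]addrACA [RHS]addrACA.
Qed.

Lemma cherednikZ j a f : D j (a *: f) = a *: D j f.
Proof.
have D0 : D j 0 = 0.
  by have := cherednik_linear j (-1) 0 0; rewrite !scaleN1r oppr0 addr0 addNr.
by rewrite -[a *: f]addr0 cherednik_linear D0 addr0.
Qed.

Lemma cherednik_comb j f g a b : D j (a *: f + b *: g) = a *: D j f + b *: D j g.
Proof. by rewrite cherednik_linear cherednikZ. Qed.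

Lemma cherednik_act_far (i i' j : 'I_n) f : i' = i.+1 :> nat -> j != i -> j != i' ->
  D j (act (tperm i i') f) = act (tperm i i') (D j f).
Proof.
move=> ii' ji ji'; rewrite /cherednik_gen !actD !actZ (actM H) (actX H) act_dunkl.
rewrite act_sum !tpermD 1?eq_sym //; congr (_ + _ *: _).
rewrite (reindex_inj (@perm_inj _ (tperm i i'))) /=; apply: eq_big => [l|l _].
  case: tpermP => [->|->|//]; move: ji ji'; rewrite -!val_eqE /= ii'; lia.
by rewrite [RHS]act_tperm (@tpermD _ i i' j) 1?eq_sym.
Qed.

(** With [cherednik_act_far], the relations of the degenerate affine Hecke algebra. The summand
    [K *: f] stems from the transposition of [i] and [i'], which occurs in [D i] but not in
    [D i']. *)
Lemma act_cherednik (i i' : 'I_n) f : i' = i.+1 :> nat ->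
  act (tperm i i') (D i f) = D i' (act (tperm i i') f) + K *: f.
Proof.
move=> ii'; rewrite /cherednik_gen !actD !actZ (actM H) (actX H) act_dunkl.
rewrite act_sum !tpermL -!addrA; congr (_ + (_ + _)); rewrite -scalerDr; congr (_ *: _).
rewrite (bigD1 i') /=; last by rewrite ii'.
rewrite act_tpermK addrC; congr (_ + _); apply: eq_big => [l|l].
  by rewrite -val_eqE /= ii'; lia.
rewrite -val_eqE /= ii' => /andP[il li'].
rewrite act_tperm tpermL tpermD // -val_eqE /=; lia.
Qed.

(** The intertwiner [s_i + c]. The condition on [c] is written without division so that it also
    covers [K = 0]. *)
Lemma cherednik_swap_eigen (i i' : 'I_n) (x : 'I_n -> F) (c : F) f :
  i' = i.+1 :> nat -> (forall j, D j f = x j *: f) -> c * (x i' - x i) = K ->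
  forall j, D j (act (tperm i i') f + c *: f)
            = x (tperm i i' j) *: (act (tperm i i') f + c *: f).
Proof.
move=> ii' fx cK j; have Di' : D i' (act (tperm i i') f) = x i *: act (tperm i i') f - K *: f.
  by apply/eqP; rewrite eq_sym subr_eq -act_cherednik // fx actZ.
have Di : D i (act (tperm i i') f) = x i' *: act (tperm i i') f + K *: f.
  apply: (can_inj (@act_tpermK i i')).
  by rewrite act_cherednik // actD !actZ !act_tpermK fx.
rewrite -[act _ f]scale1r cherednik_comb !scale1r fx scalerDr.
case: tpermP => [->|->|/eqP ji /eqP ji'].
- rewrite Di -addrA; congr (_ + _); rewrite !scalerA -scalerDl -cK; congr (_ *: _); ring.
- rewrite Di' -addrA; congr (_ + _); rewrite !scalerA -scaleNr -scalerDl -cK; congr (_ *: _); ring.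
- by rewrite cherednik_act_far // fx actZ !scalerA mulrC.
Qed.

(** Spectral projection: a suitable product of operators [D j - y] kills every summand whose
    spectrum differs from [t] and multiplies the others by one common nonzero scalar. *)
Lemma cherednik_eigen_sum (J1 J2 : eqType) (r1 : seq J1) (r2 : seq J2)
    (e1 : J1 -> 'I_n -> F) (e2 : J2 -> 'I_n -> F) (u1 : J1 -> A) (u2 : J2 -> A)
    (t : 'I_n -> F) :
  (forall i j, i \in r1 -> D j (u1 i) = e1 i j *: u1 i) ->
  (forall i j, i \in r2 -> D j (u2 i) = e2 i j *: u2 i) ->
  \sum_(i <- r1) u1 i = \sum_(i <- r2) u2 i ->
  \sum_(i <- r1 | [forall j, e1 i j == t j]) u1 i
  = \sum_(i <- r2 | [forall j, e2 i j == t j]) u2 i.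
Proof.
move=> D1 D2 eqs.
(* [W L x] is the scalar by which the product of the [D j - y], [(j, y)] in [L], acts on a joint
   eigenvector with eigenvalues [x]. *)
pose W (L : seq ('I_n * F)) (x : 'I_n -> F) : F := \prod_(a <- L) (x a.1 - a.2).
have eqW L : \sum_(i <- r1) W L (e1 i) *: u1 i = \sum_(i <- r2) W L (e2 i) *: u2 i.
  elim: L => [|[j y] L IH].
    rewrite (eq_bigr u1) => [|i _]; last by rewrite /W big_nil scale1r.
    by rewrite [RHS](eq_bigr u2) // => i _; rewrite /W big_nil scale1r.
  have step (J : eqType) (r : seq J) (e : J -> 'I_n -> F) (u : J -> A) :
      (forall i j, i \in r -> D j (u i) = e i j *: u i) ->
      \sum_(i <- r) W ((j, y) :: L) (e i) *: u i =
      D j (\sum_(i <- r) W L (e i) *: u i) - y *: \sum_(i <- r) W L (e i) *: u i.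
    move=> De; rewrite (linear_sum_of _ _ _ (cherednik_linear j)) scaler_sumr -sumrB.
    apply: eq_big_seq => i ir; rewrite /W big_cons /= -/(W L (e i)).
    rewrite cherednikZ De //.
    by rewrite mulrBl scalerBl !scalerA [_ * e i j]mulrC.
  by rewrite !step // IH.
(* One factor that vanishes at [x] but not at [t]; the list is empty if [x] agrees with [t]. *)
pose sep (x : 'I_n -> F) := if [pick j | x j != t j] is Some j then [:: (j, x j)] else [::].
have sep0 x L : [exists j, x j != t j] -> {subset sep x <= L} -> W L x = 0.
  rewrite /sep => /existsP[j xj]; case: pickP => [l _ sub|/(_ j)]; last by rewrite xj.
  apply/eqP; rewrite prodf_seq_eq0; apply/hasP; exists (l, x l) => /=; last by rewrite subrr.
  by apply: sub; rewrite mem_seq1.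
have sept x a : a \in sep x -> t a.1 - a.2 != 0.
  rewrite /sep; case: pickP => [l xl|//]; rewrite mem_seq1 => /eqP -> /=.
  by rewrite subr_eq0 eq_sym.
pose L := flatten [seq sep (e1 i) | i <- r1] ++ flatten [seq sep (e2 i) | i <- r2].
have Lt : W L t != 0.
  rewrite prodf_seq_neq0; apply/allP => a; rewrite mem_cat => /orP[] /flatten_mapP[i _];
  exact: sept.
have res (J : eqType) (r : seq J) (e : J -> 'I_n -> F) (u : J -> A) :
    (forall i, i \in r -> {subset sep (e i) <= L}) ->
    \sum_(i <- r) W L (e i) *: u i = W L t *: \sum_(i <- r | [forall j, e i j == t j]) u i.
  move=> sub; rewrite (bigID (fun i => [forall j, e i j == t j])) /= [X in _ + X]big_seq_cond.
  rewrite [X in _ + X]big1 ?addr0.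
    rewrite scaler_sumr; apply: eq_bigr => i /forallP et; congr (_ *: _).
    by apply: eq_bigr => a _; rewrite (eqP (et a.1)).
  by move=> i /andP[ir]; rewrite negb_forall => ne; rewrite sep0 ?scale0r //; apply: sub.
have := eqW L; rewrite !res => [/(congr1 (fun x => (W L t)^-1 *: x))|i ir a ai|i ir a ai].
- by rewrite !scalerA mulVf // !scale1r.
- by rewrite mem_cat; apply/orP; right; apply/flatten_mapP; exists i.
- by rewrite mem_cat; apply/orP; left; apply/flatten_mapP; exists i.
Qed.

(** Conjugation by an adjacent transposition lowers the distance between [i] and [j] by one. *)
Lemma act_adjacent f : (forall i i' : 'I_n, i' = i.+1 :> nat -> act (tperm i i') f = f) ->
  forall i j, act (tperm i j) f = f.
Proof.
move=> adj; suff lt (d : nat) (i j : 'I_n) : (j = i + d.+1 :> nat)%N -> act (tperm i j) f = f.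
  move=> i j; case: (ltngtP i j) => [ij|ji|/val_inj ->].
  - by apply: (lt (j - i).-1); lia.
  - by rewrite tpermC; apply: (lt (i - j).-1); lia.
  - by rewrite tperm1 (act1m H).
elim: d j => [|d IH] j ij; first by apply: adj; rewrite ij addn1.
have jn : (i + d.+1 < n)%N by move: (ltn_ord j); lia.
pose j' := Ordinal jn; have jj' : j = j'.+1 :> nat by rewrite ij /= addnS.
have ij' : i != j by rewrite -val_eqE /=; lia.
have ij'' : i != j' by rewrite -val_eqE /=; lia.
have -> : tperm i j = (tperm i j' ^ tperm j' j)%g.
  by rewrite tpermJ tpermL tpermD // eq_sym.
by rewrite /conjg tpermV !(actMm H) (adj _ _ jj') IH // (adj _ _ jj').
Qed.

End DunklCalculus.

(** * The raising operator of Knop and Sahi *)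

Section CyclicShift.
Variables (F : fieldType) (A : comAlgType F) (n : nat) (K : F).
Variables (X : 'I_n.+1 -> A) (act : 'S_n.+1 -> A -> A) (der : 'I_n.+1 -> A -> A).
Variable dd : 'I_n.+1 -> 'I_n.+1 -> A -> A.
Hypothesis H : dunkl_calculus X act der dd.
Local Notation T := (dunkl_gen K der dd).
Local Notation D := (cherednik_gen K X act der dd).

Lemma ord_pred_inj : injective (fun i : 'I_n.+1 => ord_pred i).
Proof. by move=> i j /(congr1 (@ordS _)); rewrite !ord_predK. Qed.

Definition shift_perm : 'S_n.+1 := perm ord_pred_inj.

(** With [N = n.+1] variables this is the affine intertwiner sending [f] to
    [x_N f(x_N, x_1, .., x_(N-1))]. *)
Definition raising (f : A) : A := X ord_max * act shift_perm f.

Lemma shift_perm0 : shift_perm ord0 = ord_max.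
Proof. by rewrite permE; apply/val_inj; rewrite /= modn_small. Qed.

Lemma shift_permS (j j' : 'I_n.+1) : j' = j.+1 :> nat -> shift_perm j' = j.
Proof.
move=> jj'; rewrite permE; apply/val_inj; rewrite /= jj' addSn /=.
by rewrite modnDr modn_small.
Qed.

(** Moving [T j] past [X ord_max] costs [K] times a transposition. It cancels the summand
    [i = ord_max] of [D j], where the transposition turns [X ord_max] into [X j]. *)
Lemma raising_cherednik (j j' : 'I_n.+1) f : j' = j.+1 :> nat ->
  D j (raising f) = raising (D j' f).
Proof.
move=> jj'; have jn : ord_max != j by rewrite -val_eqE /=; move: (ltn_ord j'); lia.
rewrite /raising /cherednik_gen !(actD H) !(actZ H) (actM H) (actX H) (act_dunkl _ H).
rewrite (act_sum H) (shift_permS jj') (dunklMX_neq _ H) //; set g := act shift_perm f.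
rewrite (bigD1 ord_max) /=; last by move: (ltn_ord j'); lia.
rewrite (actM H) (actX H) tpermR.
have -> : \sum_(i < n.+1 | (j < i)%N && (i != ord_max)) act (tperm j i) (X ord_max * g)
    = X ord_max * \sum_(i < n.+1 | (j' < i)%N) act shift_perm (act (tperm j' i) f).
  rewrite mulr_sumr [RHS](reindex_inj (@perm_inj _ (shift_perm^-1)%g)) /=.
  apply: eq_big => [i|i /andP[ji im]].
    have [i0|[i' ii']] : i = ord_max \/ exists i' : 'I_n.+1, i' = i.+1 :> nat.
      have [ilt|ige] := ltnP i n; first by right; exists (Ordinal (ilt : (i.+1 < n.+1)%N)).
      by left; apply/val_inj; move: (ltn_ord i) => /=; lia.
    - rewrite i0 eqxx andbF; have -> : (shift_perm^-1)%g ord_max = ord0.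
        by rewrite -shift_perm0 permK.
      by rewrite ltn0.
    - have -> : (shift_perm^-1)%g i = i' by rewrite -(shift_permS ii') permK.
      have im : i != ord_max by rewrite -val_eqE /=; move: (ltn_ord i'); lia.
      by rewrite ii' jj' ltnS im andbT.
  rewrite (act_tperm H) permKV (shift_permS jj') (actM H) (actX H) (@tpermD _ j i ord_max) // eq_sym //.
rewrite tpermC; set S := \sum_(i < _ | _) _; set c := K * (1 - _); set f' := dunkl_gen _ _ _ _ _.
clearbody S c f' g.
rewrite mulrBr !mulrDr -!scalerAr scalerDr [X j * (X _ * f')]mulrCA.
ring.
Qed.

(** No index lies above [ord_max], so [D ord_max] has no transpositions of its own. The commutator
    of [T] and [X] at [ord_max] supplies those of [D ord0], and its identity term gives the extra
    [f]. *)
Lemma raising_cherednik_max f :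
  D ord_max (raising f) = raising (D ord0 f + f).
Proof.
rewrite /raising /cherednik_gen !(actD H) !(actZ H) (actM H) (actX H) (act_dunkl _ H).
rewrite (act_sum H) shift_perm0 (dunklMX_eq _ H); set g := act shift_perm f.
rewrite [\sum_(i < n.+1 | (ord_max < i)%N) _]big_pred0 ?scaler0 ?addr0; last first.
  by move=> i; apply/negbTE; rewrite -leqNgt -ltnS ltn_ord.
have -> : \sum_(i | i != ord_max) act (tperm i ord_max) g =
   \sum_(i < n.+1 | ((ord0 : 'I_n.+1) < i)%N) act shift_perm (act (tperm ord0 i) f).
  rewrite [LHS](reindex_inj (@perm_inj _ shift_perm)) /=; apply: eq_big => [i|i i0].
    by rewrite -shift_perm0 (inj_eq perm_inj) -val_eqE /= lt0n.
  by rewrite (act_tperm H) shift_perm0 tpermC.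
rewrite scalerAr -mulrDr; congr (_ * _); rewrite -!addrA; congr (_ + _).
by rewrite addrA addrC; congr (_ + _); rewrite addrC.
Qed.

End CyclicShift.

(** * Ranks of parts, and how swapping and raising act on compositions *)

Section Compositions.
Variable n : nat.
Implicit Types (eta : mpoly.multinom n) (i j : 'I_n).

(* The order in which the parts of [eta] appear in its decreasing rearrangement:
   by decreasing value, ties broken by the index. *)
Definition precedes eta i j : bool :=
  (eta j < eta i)%N || ((eta i == eta j) && (i < j)%N).

(** The zero-based position that the part at [j] takes in [eplus eta], as [eplus_crank] confirms. *)
Definition crank eta j : nat := #|[set i | precedes eta i j]%SET|.

Lemma precedes_irr eta i : precedes eta i i = false.
Proof. by rewrite /precedes !ltnn andbF. Qed.

Lemma precedes_trans eta : transitive (precedes eta).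
Proof. by move=> b a c; rewrite /precedes; lia. Qed.

Lemma precedes_total eta i j : i != j -> precedes eta i j || precedes eta j i.
Proof. by rewrite -val_eqE /precedes /=; lia. Qed.

Lemma crank_lt eta i j : precedes eta i j -> (crank eta i < crank eta j)%N.
Proof.
move=> ij; apply: proper_card; apply/(@properP _ [set a | precedes eta a i]%SET [set a | precedes eta a j]%SET); split.
  by apply/fintype.subsetP => a; rewrite !inE => ai; apply: precedes_trans ai ij.
by exists i; rewrite inE ?precedes_irr.
Qed.

Lemma crank_ltn eta j : (crank eta j < n)%N.
Proof.
have sub : [set i | precedes eta i j]%SET \subset [set~ j]%SET.
  by apply/fintype.subsetP => a; rewrite !inE; case: eqVneq => [->|//]; rewrite precedes_irr.
have := subset_leq_card sub; rewrite cardsC1 card_ord /crank.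
by move: (ltn_ord j); lia.
Qed.

Lemma precedes_crank eta i j : precedes eta i j = (crank eta i < crank eta j)%N.
Proof.
apply/idP/idP; first exact: crank_lt.
case: (eqVneq i j) => [->|/(precedes_total eta)/orP[//|/crank_lt]]; first by rewrite ltnn.
by move=> /ltnW; rewrite leqNgt => /negPf ->.
Qed.

Definition crank_ord eta j : 'I_n := Ordinal (crank_ltn eta j).

Lemma crank_ord_inj eta : injective (crank_ord eta).
Proof.
move=> i j /(congr1 val) /= e; apply/eqP/negPn/negP => /(precedes_total eta).
by rewrite !precedes_crank e ltnn.
Qed.

(** Listing the parts in the order of their ranks gives a sorted rearrangement, and a sorted
    rearrangement is unique. *)
Lemma eplus_crank eta j : eplus eta (crank_ord eta j) = eta j.
Proof.
pose p := perm (@crank_ord_inj eta); pose t := [tuple eta ((p^-1)%g i) | i < n].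
suff e : sort_tuple geq (mpoly.multinom_val eta) = t.
  rewrite /eplus mpoly.mnm_tnth e tnth_mktuple; congr (mpoly.fun_of_multinom eta _).
  by rewrite -[crank_ord eta j](permE (@crank_ord_inj eta)) permK.
apply/val_inj => /=; apply: (sorted_eq (leT := geq)).
- by move=> a b c /= ab bc; apply: leq_trans bc ab.
- by move=> a b; rewrite /= andbC => /anti_leq.
- by apply: sort_sorted => a b; apply: leq_total.
- apply/(sortedP 0%N) => i; rewrite size_tuple => i1.
  have i0 := ltnW i1; rewrite /t.
  have n1 : (i.+1 < n)%N by move: i1; rewrite card_ord.
  rewrite !(nth_map (Ordinal n1)) -?enumT ?size_enum_ord ?(ltnW n1) //.
  set a := nth _ _ i; set b := nth _ _ i.+1.
  have : precedes eta ((p^-1)%g a) ((p^-1)%g b).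
    rewrite precedes_crank; have pa c : crank eta ((p^-1)%g c) = c.
      by rewrite -{2}[c](permKV p) [X in _ = nat_of_ord X]permE.
    by rewrite !pa /a /b !nth_enum_ord // ltnW.
  by rewrite /precedes /=; lia.
- rewrite perm_sort perm_sym; apply/tuple_permP; exists (p^-1)%g.
  by congr tval; apply: eq_from_tnth => i; rewrite !tnth_mktuple.
Qed.

Lemma mdeg_eplus eta : mpoly.mdeg (eplus eta) = mpoly.mdeg eta.
Proof.
rewrite !mpoly.mdegE (reindex_inj (@crank_ord_inj eta)) /=.
by apply: eq_bigr => j _; rewrite eplus_crank.
Qed.

Definition mact (s : 'S_n) eta : mpoly.multinom n :=
  mpoly.Multinom [tuple eta (s i) | i < n].

Lemma mactE s eta i : mact s eta i = eta (s i).
Proof. by rewrite /mact mpoly.mnmE. Qed.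

Lemma mdeg_mact s eta : mpoly.mdeg (mact s eta) = mpoly.mdeg eta.
Proof.
rewrite !mpoly.mdegE [RHS](reindex_inj (@perm_inj _ s)) /=.
by apply: eq_bigr => j _; rewrite mactE.
Qed.

Lemma mact_tpermK i j : involutive (mact (tperm i j)).
Proof. by move=> eta; apply/mpoly.mnmP => l; rewrite !mactE tpermK. Qed.

(** No index lies between [i] and [i'], so only their own index order changes, and this order
    decides nothing when the two parts differ. *)
Lemma crank_swap eta (i i' : 'I_n) j : i' = i.+1 :> nat -> eta i != eta i' ->
  crank (mact (tperm i i') eta) j = crank eta (tperm i i' j).
Proof.
move=> ii' ne; rewrite /crank -(card_imset _ (@perm_inj _ (tperm i i'))).
apply: eq_card => a; rewrite [RHS]inE.
apply/imsetP/idP => [[b]|pa].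
  rewrite inE => pb ->; move: pb; rewrite /precedes !mactE.
  case: tpermP => [->|->|/eqP ji /eqP ji']; case: tpermP => [->|->|/eqP bi /eqP bi'];
    do ?[move: ji]; do ?[move: ji']; do ?[move: bi]; do ?[move: bi']; move: ne;
    rewrite -?val_eqE /= ?ii'; lia.
exists (tperm i i' a); rewrite ?tpermK // inE; move: pa; rewrite /precedes !mactE tpermK.
case: tpermP => [->|->|/eqP ji /eqP ji']; case: tpermP => [->|->|/eqP bi /eqP bi'];
    do ?[move: ji]; do ?[move: ji']; do ?[move: bi]; do ?[move: bi']; move: ne;
    rewrite -?val_eqE /= ?ii'; lia.
Qed.

End Compositions.

Section CompositionsOfDegree.
Variable n : nat.
Implicit Types eta : mpoly.multinom n.

Definition comps (m : nat) : seq (mpoly.multinom n) :=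
  [seq mpoly.bmnm e | e : mpoly.bmultinom n m.+1 <- enum {: mpoly.bmultinom n m.+1} & mpoly.mdeg e == m].

Lemma mem_comps m eta : (eta \in comps m) = (mpoly.mdeg eta == m).
Proof.
apply/mapP/eqP => [[e]|em]; first by rewrite mem_filter => /andP[/eqP em _] ->.
have b : (mpoly.mdeg eta < m.+1)%N by rewrite em.
by exists (mpoly.BMultinom b) => //; rewrite mem_filter mem_enum /= em eqxx.
Qed.

Lemma comps_uniq m : uniq (comps m).
Proof.
rewrite map_inj_uniq ?filter_uniq -?enumT ?enum_uniq // => x y xy.
by apply/eqP; rewrite mpoly.bmeqP; apply/eqP.
Qed.

Lemma big_comps (V : nmodType) m (f : mpoly.multinom n -> V) :
  \sum_(e : mpoly.bmultinom n m.+1 | mpoly.mdeg e == m) f e = \sum_(e <- comps m) f e.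
Proof. by rewrite big_map big_filter big_enum_cond. Qed.

Lemma perm_comps_mact s m : perm_eq [seq mact s eta | eta <- comps m] (comps m).
Proof.
apply: uniq_perm; [|exact: comps_uniq|move=> eta].
  rewrite map_inj_uniq ?comps_uniq // => e f ef; apply/mpoly.mnmP => i.
  by have := congr1 (fun g : mpoly.multinom n => g ((s^-1)%g i)) ef; rewrite !mactE permKV.
rewrite mem_comps; apply/mapP/idP => [[e]|em].
  by rewrite mem_comps => em ->; rewrite mdeg_mact.
exists (mact (s^-1)%g eta); first by rewrite mem_comps mdeg_mact.
by apply/mpoly.mnmP => i; rewrite !mactE permK.
Qed.

Lemma big_seq_only (V : nmodType) (I : eqType) (r : seq I) (P : pred I) (f : I -> V) i0 :
  uniq r -> i0 \in r -> P i0 -> (forall i, i \in r -> P i -> i = i0) ->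
  \sum_(i <- r | P i) f i = f i0.
Proof.
move=> ur ir Pi0 only; rewrite -big_filter -[RHS](big_seq1 +%R i0 f).
apply: perm_big; apply: uniq_perm => [||i]; rewrite ?filter_uniq // mem_filter mem_seq1.
by apply/andP/eqP => [[Pi ri]|->]; [apply: only|].
Qed.

End CompositionsOfDegree.

Section RaisedComposition.
Variable n : nat.
Implicit Types (eta : mpoly.multinom n.+1) (i j : 'I_n.+1).

(** The effect of [raising] on the exponent of a monomial. *)
Definition mraise eta : mpoly.multinom n.+1 :=
  mpoly.Multinom [tuple (eta (ordS i) + (i == ord_max))%N | i < n.+1].

Definition mlower eta : mpoly.multinom n.+1 :=
  mpoly.Multinom [tuple (eta (ord_pred i) - (i == ord0))%N | i < n.+1].

Lemma mraiseE eta i : mraise eta i = (eta (ordS i) + (i == ord_max))%N.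
Proof. by rewrite /mraise mpoly.mnmE. Qed.

Lemma ordS_max : ordS ord_max = ord0 :> 'I_n.+1.
Proof. by apply/val_inj; rewrite /= modnn. Qed.

Lemma ordS_lt i : i != ord_max -> ordS i = i.+1 :> nat.
Proof. by rewrite -val_eqE /= => im; rewrite modn_small //; move: (ltn_ord i) im; lia. Qed.

Lemma mdeg_mraise eta : mpoly.mdeg (mraise eta) = (mpoly.mdeg eta).+1.
Proof.
rewrite !mpoly.mdegE (eq_bigr (fun i => eta (ordS i) + (i == ord_max))%N).
  rewrite big_split /= [in RHS](reindex_inj (can_inj (@ordSK n.+1))) /=.
  have -> : (\sum_(i < n.+1) (i == ord_max) = 1)%N.
    by rewrite (bigD1 ord_max) //= eqxx big1 // => i /negPf ->.
  by rewrite addn1.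
by move=> i _; rewrite mraiseE.
Qed.

Lemma mraise_max eta : (0 < mraise eta ord_max)%N.
Proof. by rewrite mraiseE eqxx addn1. Qed.

Lemma mraiseK : cancel mraise mlower.
Proof.
move=> eta; apply/mpoly.mnmP => i; rewrite /mlower mpoly.mnmE mraiseE ord_predK.
by rewrite -(inj_eq (can_inj (@ordSK n.+1))) ord_predK ordS_max addnK.
Qed.

Lemma mlowerK eta : (0 < eta ord_max)%N -> mraise (mlower eta) = eta.
Proof.
move=> e0; apply/mpoly.mnmP => i; rewrite mraiseE /mlower mpoly.mnmE ordSK.
rewrite -ordS_max (inj_eq (can_inj (@ordSK n.+1))); case: eqVneq => [->|_] /=; last lia.
by rewrite subnK.
Qed.

Lemma perm_comps_mraise m :
  perm_eq [seq mraise eta | eta <- comps n.+1 m] [seq eta : mpoly.multinom n.+1 <- comps n.+1 m.+1 | (0 < eta ord_max)%N].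
Proof.
apply: uniq_perm; [|by rewrite filter_uniq ?comps_uniq|].
  by rewrite map_inj_uniq ?comps_uniq //; apply: can_inj mraiseK.
move=> eta; rewrite mem_filter mem_comps; apply/mapP/andP => [[e]|[e0 em]].
  by rewrite mem_comps => /eqP <- ->; rewrite mraise_max mdeg_mraise.
exists (mlower eta); rewrite ?mlowerK //.
by rewrite mem_comps -eqSS -mdeg_mraise mlowerK.
Qed.

(** The first part wins every tie by its index. After its move to the end it would lose them all,
    and the added one exactly compensates for this. *)
Lemma crank_mraise eta j : crank (mraise eta) j = crank eta (ordS j).
Proof.
have Si := can_inj (@ordSK n.+1).
rewrite /crank -(card_imset _ Si); apply: eq_card => a; rewrite [RHS]inE.
have key b : precedes (mraise eta) b j = precedes eta (ordS b) (ordS j).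
  rewrite /precedes !mraiseE.
  have [->|jm] := eqVneq j ord_max; have [->|bm] := eqVneq b ord_max.
  - by lia.
  - rewrite ordS_max /=; move: bm (ltn_ord b); rewrite -val_eqE /=; lia.
  - rewrite ordS_max (ordS_lt jm) /=; move: jm (ltn_ord j); rewrite -val_eqE /=; lia.
  - rewrite (ordS_lt jm) (ordS_lt bm) !addn0; lia.
apply/imsetP/idP => [[b]|pa]; first by rewrite inE key => pb ->.
by exists (ord_pred a); rewrite ?ord_predK // inE key ord_predK.
Qed.

End RaisedComposition.

(** * The joint spectrum separates compositions *)

Section CherednikEigenvalues.
Variables (F : numFieldType) (k : F) (n : nat).
Hypothesis k0 : 0 <= k.
Implicit Types (eta zeta : mpoly.multinom n) (i j : 'I_n).

Definition eb eta j : F := (eta j)%:R - k * (crank eta j)%:R.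

Lemma eb_lt eta i j : 0 < k -> (eb eta j < eb eta i) = precedes eta i j.
Proof.
move=> kp; have lt a b : precedes eta a b -> eb eta b < eb eta a.
  move=> ab; rewrite /eb; apply: ler_ltD.
    by rewrite ler_nat; move: ab; rewrite /precedes; lia.
  by rewrite ltrN2 ltr_pM2l // ltr_nat crank_lt.
have [ij|nij] := boolP (precedes eta i j); first exact: lt.
have [<-|/(precedes_total eta)] := eqVneq i j; first by rewrite ltxx.
by rewrite (negPf nij) /= => /lt /ltW /le_gtF.
Qed.

(** For [k > 0] the order of the eigenvalues gives back the ranks and then the parts; for [k = 0]
    the eigenvalues are the parts themselves. *)
Lemma eb_inj eta zeta : eb eta =1 eb zeta -> eta = zeta.
Proof.
move=> e; apply/mpoly.mnmP => j; move: k0; rewrite le_eqVlt => /orP[/eqP kz|kp].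
  by have /eqP := e j; rewrite /eb -kz !mul0r !subr0 eqr_nat => /eqP.
have cr : crank eta j = crank zeta j.
  by rewrite /crank; apply: eq_card => i; rewrite !inE -!eb_lt // !e.
by have /eqP := e j; rewrite /eb cr (inj_eq (addIr _)) eqr_nat => /eqP.
Qed.

Lemma eb_swap_neq eta i i' j : i' = i.+1 :> nat -> eta i != eta i' ->
  eb (mact (tperm i i') eta) j = eb eta (tperm i i' j).
Proof. by move=> ii' ne; rewrite /eb mactE crank_swap. Qed.

(** Such a [zeta] would rank [i'] before [i] although its parts at [i] and [i'] are equal and
    [i < i']. *)
Lemma eb_swap_eq eta zeta i i' : 0 < k -> i' = i.+1 :> nat -> eta i = eta i' ->
  ~ (forall j, eb zeta j = eb eta (tperm i i' j)).
Proof.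
move=> kp ii' ee e.
have cr j : crank zeta j = crank eta (tperm i i' j).
  rewrite /crank -(card_imset _ (@perm_inj _ (tperm i i'))).
  apply: eq_card => a; rewrite [RHS]inE -eb_lt //.
  apply/imsetP/idP => [[b]|pa]; first by rewrite inE -eb_lt // !e => pb ->.
  by exists (tperm i i' a); rewrite ?tpermK // inE -eb_lt // !e tpermK.
have zE j : zeta j = eta (tperm i i' j).
  by have /eqP := e j; rewrite /eb cr (inj_eq (addIr _)) eqr_nat => /eqP.
have : precedes zeta i' i.
  by rewrite -eb_lt // !e tpermL tpermR eb_lt // /precedes ee ii' eqxx leqnn orbT.
by rewrite /precedes !zE tpermL tpermR ee ii' ltnn; lia.
Qed.

(** Equal parts at neighbouring positions have consecutive ranks. *)
Lemma ebB_swap eta i i' : i' = i.+1 :> nat -> eta i = eta i' ->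
  eb eta i' - eb eta i = - k.
Proof.
move=> ii' ee; have cr : crank eta i' = (crank eta i).+1.
  rewrite /crank (_ : [set a | precedes eta a i']%SET = i |: [set a | precedes eta a i]%SET)%SET.
    by rewrite cardsU1 inE precedes_irr add1n.
  apply/finset.setP => a; rewrite !inE /precedes ee ii'.
    by have [->|ai] := eqVneq a i; [|move: ai; rewrite -val_eqE /=]; lia.
rewrite /eb cr ee -natr1; ring.
Qed.

End CherednikEigenvalues.

(** * Recursions for the normalized Jack polynomials and the value of their weighted sums *)

Section JackRecursion.
Variables (F : numFieldType) (k : F) (n : nat).
Hypothesis k0 : 0 <= k.
Variable A : comAlgType F.
Variables (X : 'I_n.+1 -> A) (act : 'S_n.+1 -> A -> A) (der : 'I_n.+1 -> A -> A).
Variable dd : 'I_n.+1 -> 'I_n.+1 -> A -> A.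
Hypothesis H : dunkl_calculus X act der dd.
Variable G : mpoly.multinom n.+1 -> A.
Local Notation D := (cherednik_gen k X act der dd).
Local Notation T := (dunkl_gen k der dd).
Local Notation raise := (raising X act).
Local Notation e1 := (\sum_i X i).
Hypothesis GD : forall eta j, D j (G eta) = eb k eta j *: G eta.
Hypothesis Gsum : forall m, \sum_(eta <- comps n.+1 m) G eta = e1 ^+ m.
Implicit Types (eta zeta : mpoly.multinom n.+1) (i j : 'I_n.+1).

Lemma act_e1 s m : act s (e1 ^+ m) = e1 ^+ m.
Proof.
have a1 : act s e1 = e1.
  rewrite (act_sum H) [RHS](reindex_inj (@perm_inj _ s)) /=.
  by apply: eq_bigr => i _; rewrite (actX H).
have a0 : act s 1 = 1.
  have := actM H s (act (s^-1)%g 1) 1.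
  by rewrite mulr1 -(actMm H) mulVg (act1m H) mul1r.
by elim: m => [|m IH]; rewrite ?expr0 // exprS (actM H) IH a1.
Qed.

Lemma der_e1 i m : der i (e1 ^+ m.+1) = m.+1%:R *: e1 ^+ m.
Proof.
have d1 : der i e1 = 1.
  rewrite (linear_sum_of _ _ _ (der_linear H i)) (bigD1 i) //= (derX H) eqxx.
  by rewrite big1 ?addr0 // => j ji; rewrite (derX H) eq_sym (negPf ji).
elim: m => [|m IH]; first by rewrite expr1 d1 expr0 scale1r.
rewrite exprS (derM H) d1 IH mul1r -scalerAr -exprS -[X in X + _]scale1r -scalerDl.
by rewrite -[in RHS]natr1 addrC.
Qed.

(** The value [0] on equal parts lets [swap_relation] state in that case that [G eta] is
    invariant. *)
Definition swap_coef i i' eta : F :=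
  if eta i == eta i' then 0 else k / (eb k eta i' - eb k eta i).

Lemma eb_neq eta i i' : 0 < k -> i != i' -> eb k eta i' - eb k eta i != 0.
Proof.
move=> kp /(precedes_total eta); rewrite -!(eb_lt k0) // subr_eq0.
by case/orP => [/lt_eqF ->|/gt_eqF ->].
Qed.

Lemma swap_coefC i i' eta : i' = i.+1 :> nat ->
  swap_coef i i' (mact (tperm i i') eta) = - swap_coef i i' eta.
Proof.
move=> ii'; rewrite /swap_coef !mactE tpermL tpermR eq_sym.
case: ifPn => [_|ne]; first by rewrite oppr0.
have -> : eb k (mact (tperm i i') eta) i' - eb k (mact (tperm i i') eta) i
          = - (eb k eta i' - eb k eta i) by rewrite !eb_swap_neq // tpermL tpermR [RHS]opprB.
by rewrite invrN mulrN.
Qed.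

(** Invariance of the power of [e1] gives that the sums of [s G z + c z G z] and of [(1 + c z) G z]
    agree. The summands on the left have swapped spectra, so projecting to the swapped spectrum of
    [eta] leaves [eta] on the left and at most one term on the right. *)
Lemma swap_relation i i' eta : i' = i.+1 :> nat ->
  act (tperm i i') (G eta) =
  (1 - swap_coef i i' eta) *: G (mact (tperm i i') eta) - swap_coef i i' eta *: G eta.
Proof.
move=> ii'; have ni : i != i' by rewrite -val_eqE /= ii' neq_ltn ltnSn.
pose c zeta := k / (eb k zeta i' - eb k zeta i).
have cK zeta : c zeta * (eb k zeta i' - eb k zeta i) = k.
  move: k0; rewrite le_eqVlt => /orP[/eqP kz|kp]; first by rewrite /c -kz !mul0r.
  by rewrite /c mulfVK // eb_neq.
pose u1 zeta := act (tperm i i') (G zeta) + c zeta *: G zeta.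
pose u2 zeta := (1 + c zeta) *: G zeta.
pose t j := eb k eta (tperm i i' j).
set m := mpoly.mdeg eta; have em : eta \in comps n.+1 m by rewrite mem_comps.
have ex : \sum_(z <- comps n.+1 m | [forall j, eb k z (tperm i i' j) == t j]) u1 z
   = \sum_(z <- comps n.+1 m | [forall j, eb k z j == t j]) u2 z.
  apply: (cherednik_eigen_sum (K := k) H).
  - move=> z j _; rewrite (cherednik_swap_eigen (K := k) H (x := eb k z) ii') //.
  - by move=> z j _; rewrite (cherednikZ _ H) GD !scalerA mulrC.
  - rewrite /u1 /u2 big_split /= -(act_sum H) Gsum act_e1 -Gsum -big_split /=.
    by apply: eq_bigr => z _; rewrite scalerDl scale1r.
have lhs : \sum_(z <- comps n.+1 m | [forall j, eb k z (tperm i i' j) == t j]) u1 z = u1 eta.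
  apply: big_seq_only; rewrite ?comps_uniq //; first by apply/forallP.
  move=> z _ /forallP ez; apply: (eb_inj k0) => j.
  by have /eqP := ez (tperm i i' j); rewrite /t tpermK.
rewrite lhs {lhs} in ex; rewrite /swap_coef; case: ifPn => [/eqP ee|ne].
  have -> : mact (tperm i i') eta = eta.
    by apply/mpoly.mnmP => j; rewrite mactE; case: tpermP => [->|->|].
  rewrite subr0 scale1r scale0r subr0.
  (* Equal parts. For [k = 0] the term of [eta] survives on the right with coefficient 1. For
     [k > 0] no composition has the swapped spectrum, so the right side is [0], while
     [c eta = -1]. *)
  move: k0; rewrite le_eqVlt => /orP[/eqP kz|kp].
    have eb0 z j : eb k z j = (z j)%:R by rewrite /eb -kz mul0r subr0.
    have c0 z : c z = 0 by rewrite /c -kz mul0r.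
    move: ex; rewrite /u1 c0 scale0r addr0 => ->.
    rewrite (@big_seq_only _ _ _ _ _ eta) ?comps_uniq //.
    - by rewrite /u2 c0 addr0 scale1r.
    - by apply/forallP => j; rewrite /t !eb0; case: tpermP => [->|->|]; rewrite ?ee.
    - move=> z _ /forallP ez; apply: (eb_inj k0) => j; rewrite (eqP (ez j)) /t !eb0.
      by case: tpermP => [->|->|]; rewrite ?ee.
  have c1 : c eta = -1.
    by apply: (mulIf (eb_neq eta kp ni)); rewrite cK ebB_swap // mulrNN mul1r.
  move: ex; rewrite /u1 c1 scaleN1r big_pred0 => [/eqP|z]; first by rewrite subr_eq0 => /eqP.
  apply/negP => /forallP ez; apply: (eb_swap_eq k0 kp ii' ee (zeta := z)) => j.
  by apply/eqP/ez.
have se : mact (tperm i i') eta \in comps n.+1 m by rewrite mem_comps mdeg_mact.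
have := ex; rewrite (@big_seq_only _ _ _ _ _ (mact (tperm i i') eta)) ?comps_uniq //.
- rewrite {1}/u1 => /(canRL (addrK _)) ->; rewrite /u2; congr (_ *: _ - _).
  suff -> : c (mact (tperm i i') eta) = - c eta by [].
  have ebB : eb k (mact (tperm i i') eta) i' - eb k (mact (tperm i i') eta) i
          = - (eb k eta i' - eb k eta i) by rewrite !eb_swap_neq // tpermL tpermR [RHS]opprB.
  by rewrite /c ebB invrN mulrN.
- by apply/forallP => j; rewrite eb_swap_neq.
- move=> z _ /forallP ez; apply: (eb_inj k0) => j.
  by rewrite (eqP (ez j)) eb_swap_neq.
Qed.

(** The eigenvalue of [X ord_max * T ord_max]: at the last index [D] differs from this operator only
    by a constant. *)
Definition lower_coef eta : F := eb k eta ord_max - k * (1 - n.+1%:R).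

Lemma lower_coefE eta :
  lower_coef eta = (eta ord_max)%:R + k * (n - crank eta ord_max)%:R.
Proof.
have := crank_ltn eta ord_max; rewrite ltnS => cn.
rewrite /lower_coef /eb natrB // -natr1; ring.
Qed.

Lemma lower_coef_gt0 eta : (0 < eta ord_max)%N -> 0 < lower_coef eta.
Proof.
by move=> e0; rewrite lower_coefE ltr_wpDr ?ltr0n // mulr_ge0.
Qed.

(** Every other index precedes a last part equal to [0], whose rank is therefore [n]. So exactly the
    raised compositions contribute to a sum weighted by [lower_coef]. *)
Lemma lower_coef_eq0 eta : eta ord_max = 0%N -> lower_coef eta = 0.
Proof.
move=> e0; rewrite lower_coefE e0 add0r; suff -> : crank eta ord_max = n.
  by rewrite subnn mulr0.
have := cardsC1 (ord_max : 'I_n.+1); rewrite card_ord /= => cn; rewrite -[RHS]cn.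
rewrite /crank; apply: eq_card => i; rewrite !inE /precedes.
have [->|im] := eqVneq i ord_max; first by rewrite !ltnn andbF.
by move: im (ltn_ord i); rewrite e0 -val_eqE /=; lia.
Qed.

Lemma lower_relation eta : X ord_max * T ord_max (G eta) = lower_coef eta *: G eta.
Proof.
have := GD eta ord_max; rewrite {1}/cherednik_gen [X in _ + k *: X]big_pred0; last first.
  by move=> i; apply/negbTE; rewrite -leqNgt -ltnS ltn_ord.
by rewrite scaler0 addr0 => e; rewrite /lower_coef scalerBl -e addrK.
Qed.

(** On the symmetric power [e1 ^+ m.+1] the operator [T ord_max] is the plain derivative, so
    [X ord_max * T ord_max] sends it to [m.+1] times [raise (e1 ^+ m)]. Expanding both powers and
    isolating the spectrum of [mraise eta] gives the claim. *)
Lemma raise_relation eta :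
  (mpoly.mdeg eta).+1%:R *: raise (G eta) = lower_coef (mraise eta) *: G (mraise eta).
Proof.
set m := mpoly.mdeg eta; have em : eta \in comps n.+1 m by rewrite mem_comps.
pose u1 z := lower_coef z *: G z.
pose u2 z := m.+1%:R *: raise (G z).
have rD : forall z j, D j (u2 z) = eb k (mraise z) j *: u2 z.
  move=> z j; rewrite /u2 (cherednikZ _ H) scalerA [_ * m.+1%:R]mulrC -scalerA; congr (_ *: _).
  have rZ a f : raise (a *: f) = a *: raise f by rewrite /raising (actZ H) scalerAr.
  have [->|jm] := eqVneq j ord_max.
    rewrite (raising_cherednik_max _ H) GD -[X in _ + X]scale1r -scalerDl rZ.
    congr (_ *: _); rewrite /eb crank_mraise mraiseE eqxx ordS_max addn1 -natr1; ring.
  rewrite (raising_cherednik _ H (j' := ordS j)) ?ordS_lt // GD rZ; congr (_ *: _).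
  by rewrite /eb crank_mraise mraiseE (negPf jm) addn0.
have ex : \sum_(z <- comps n.+1 m.+1 | [forall j, eb k z j == eb k (mraise eta) j]) u1 z
   = \sum_(z <- comps n.+1 m | [forall j, eb k (mraise z) j == eb k (mraise eta) j]) u2 z.
  apply: (cherednik_eigen_sum (K := k) H).
  - by move=> z j _; rewrite (cherednikZ _ H) GD !scalerA mulrC.
  - by move=> z j _; apply: rD.
  - rewrite (eq_bigr (fun z => X ord_max * T ord_max (G z))); last first.
      by move=> z _; rewrite lower_relation.
    rewrite -mulr_sumr -(linear_sum_of _ _ _ (dunkl_gen_linear _ H ord_max)) Gsum.
    rewrite (dunkl_sym _ H) => [|i]; last exact: act_e1.
    rewrite der_e1 -scaler_sumr /raising -mulr_sumr -(act_sum H) Gsum act_e1.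
    by rewrite scalerAr.
move: ex; rewrite (@big_seq_only _ _ _ _ _ (mraise eta)) ?comps_uniq //.
- rewrite (@big_seq_only _ _ _ _ _ eta) ?comps_uniq //; first by apply/forallP.
  move=> z _ /forallP ez; apply: (can_inj (@mraiseK n)); apply: (eb_inj k0) => j.
  exact/eqP/ez.
- by rewrite mem_comps mdeg_mraise.
- exact/forallP.
- by move=> z _ /forallP ez; apply: (eb_inj k0) => j; apply/eqP/ez.
Qed.

(** Parts and ranks both differ by at least one, so the eigenvalues differ by more than [k]. With
    these bounds [swap_relation] can be solved for the swapped composition with nonnegative
    coefficients. *)
Lemma swap_coef_bounds i i' eta : i' = i.+1 :> nat -> (eta i < eta i')%N ->
  0 <= swap_coef i i' eta < 1.
Proof.
move=> ii' lt; have p : precedes eta i' i by rewrite /precedes lt.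
have cl := crank_lt p; rewrite /swap_coef ifN ?ltn_eqF //.
have -> : eb k eta i' - eb k eta i = (eta i' - eta i)%:R + k * (crank eta i - crank eta i')%:R.
  by rewrite /eb !natrB ?(ltnW lt) ?(ltnW cl) //; ring.
set d := (crank _ _ - _)%N; have d1 : 1 <= d%:R :> F by rewrite ler1n /d subn_gt0.
have xk : k < (eta i' - eta i)%:R + k * d%:R.
  by rewrite ltr_pwDl ?ltr0n ?subn_gt0 // ler_peMr.
have x0 := le_lt_trans k0 xk.
by rewrite divr_ge0 ?(ltW x0) //= ltr_pdivrMr // mul1r.
Qed.

(** Induction on the degree, and within a degree on the distance of some positive part from the last
    position. At the last position [raise_relation] applies; elsewhere the part is moved by
    [swap_relation]. *)
Lemma jack_ind (P : nat -> A -> Prop) :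
  P 0%N 1 -> (forall m s f, P m f -> P m (act s f)) ->
  (forall m i f, P m f -> P m.+1 (X i * f)) ->
  (forall m f g, P m f -> P m g -> P m (f + g)) ->
  (forall m c f, 0 <= c -> P m f -> P m (c *: f)) ->
  forall eta, P (mpoly.mdeg eta) (G eta).
Proof.
move=> P0 Pact PX PD PZ eta; move em: (mpoly.mdeg eta) => m; elim: m eta em => [|m IHm] eta em.
  have := Gsum 0; rewrite expr0 => G0.
  suff -> : G eta = 1 by [].
  rewrite -G0 -(@big_seq_only _ _ (comps n.+1 0) predT G eta) ?comps_uniq //.
    by rewrite mem_comps em.
  move=> z; rewrite mem_comps mpoly.mdeg_eq0 => /eqP -> _.
  by apply/esym/eqP; rewrite -mpoly.mdeg_eq0 em.
have Pmax z : mpoly.mdeg z = m.+1 -> (0 < z ord_max)%N -> P m.+1 (G z).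
  move=> zm z0; have dz : mpoly.mdeg (mlower z) = m.
    by apply: succn_inj; rewrite -mdeg_mraise mlowerK.
  have := raise_relation (mlower z); rewrite mlowerK // => e.
  have l0 := lower_coef_gt0 z0.
  have -> : G z = ((lower_coef z)^-1 * (mpoly.mdeg (mlower z)).+1%:R) *: raise (G (mlower z)).
    by rewrite -scalerA e scalerA mulVf ?gt_eqF // scale1r.
  apply: PZ; first by rewrite mulr_ge0 // invr_ge0 ltW.
  by apply: PX; apply: Pact; apply: IHm.
have [j ej] : exists j, (0 < eta j)%N.
  apply/existsP; apply: contraT; rewrite negb_exists => /forallP z.
  move: em; rewrite mpoly.mdegE big1 // => j _.
  by apply/eqP; rewrite -leqn0 leqNgt; apply: z.
move dj: (n - j)%N => d; elim: d j eta em ej dj => [|d IHd] j eta em ej dj.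
  apply: Pmax => //; suff <- : j = ord_max by [].
  by apply/val_inj => /=; move: (ltn_ord j); lia.
have jn : (j.+1 < n.+1)%N by lia.
pose j' : 'I_n.+1 := Ordinal jn; have jj' : j' = j.+1 :> nat by [].
(* If the next part is positive, it serves instead of [j]. Otherwise [G eta] is recovered from the
   swap [z], whose positive part stands one place further to the right. *)
have [ej'|] := posnP (eta j'); last by move/(IHd j' eta em); apply; rewrite /=; lia.
pose z := mact (tperm j j') eta.
have zj : z j = 0%N by rewrite /z mactE tpermL.
have zj' : z j' = eta j by rewrite /z mactE tpermR.
have Pz : P m.+1 (G z).
  by apply: (IHd j'); rewrite ?zj' // /z ?mdeg_mact //=; lia.
have := swap_relation z jj'; rewrite {1}/z mact_tpermK.
have /andP[c0 c1] : 0 <= swap_coef j j' z < 1 by apply: swap_coef_bounds; rewrite // zj zj'.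
set c := swap_coef _ _ _ in c0 c1 *; move=> /eqP; rewrite eq_sym subr_eq => /eqP e.
have c1' : 1 - c != 0 by rewrite subr_eq0 gt_eqF.
have -> : G eta = (1 - c)^-1 *: (act (tperm j j') (G z) + c *: G z).
  by rewrite -e scalerA mulVf // scale1r.
apply: (PZ); first by rewrite invr_ge0 subr_ge0 ltW.
by apply: PD; [apply: Pact|apply: PZ].
Qed.

(** The generalized Pochhammer symbol of [eplus eta], taken in the original order of the parts so
    that the effect of swapping and raising is visible. *)
Definition wpoch (a : F) eta : F :=
  \prod_j \prod_(l < eta j) (a - k * (crank eta j)%:R + l%:R).

Lemma wpoch_swap a i i' eta : i' = i.+1 :> nat ->
  wpoch a (mact (tperm i i') eta) = wpoch a eta.
Proof.
move=> ii'; have [ee|ne] := eqVneq (eta i) (eta i').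
  congr wpoch; apply/mpoly.mnmP => j; rewrite mactE.
  by case: tpermP => [->|->|].
rewrite /wpoch [RHS](reindex_inj (@perm_inj _ (tperm i i'))) /=.
by apply: eq_bigr => j _; rewrite crank_swap // mactE.
Qed.

(** The factor of the new box is [a] plus the eigenvalue of [D ord0], so passing to the next degree
    amounts to applying [a + D ord0]. *)
Lemma wpoch_mraise a eta : wpoch a (mraise eta) = wpoch a eta * (a + eb k eta ord0).
Proof.
rewrite /wpoch [in RHS](reindex_inj (can_inj (@ordSK n.+1))) /=.
rewrite (bigD1 ord_max) //= [in RHS](bigD1 ord_max) //= ordS_max.
rewrite mraiseE eqxx addn1 ordS_max big_ord_recr /= crank_mraise ordS_max.
rewrite [in LHS](eq_bigr (fun j => \prod_(l < eta (ordS j)) (a - k * (crank eta (ordS j))%:R + l%:R))).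
  by rewrite /eb; ring.
by move=> j jm; rewrite mraiseE (negPf jm) addn0 crank_mraise.
Qed.

Definition jack_gen a m : A := \sum_(eta <- comps n.+1 m) wpoch a eta *: G eta.

(** A swap preserves the weight and negates [swap_coef]; after reindexing, the weight of [G z] is
    multiplied by [(1 + c) - c = 1]. *)
Lemma jack_gen_sym a m i j : act (tperm i j) (jack_gen a m) = jack_gen a m.
Proof.
move: i j; apply: (act_adjacent H) => i i' ii'; rewrite (act_sum H).
rewrite (eq_bigr (fun z => (wpoch a z * (1 - swap_coef i i' z)) *: G (mact (tperm i i') z)
     - (wpoch a z * swap_coef i i' z) *: G z)); last first.
  by move=> z _; rewrite (actZ H) swap_relation // scalerBr !scalerA.
rewrite sumrB; have -> : \sum_(z <- comps n.+1 m)
     (wpoch a z * (1 - swap_coef i i' z)) *: G (mact (tperm i i') z)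
   = \sum_(z <- comps n.+1 m) (wpoch a z * (1 + swap_coef i i' z)) *: G z.
  rewrite -[RHS](perm_big _ (perm_comps_mact (tperm i i') m)) [RHS]big_map /=.
  by apply: eq_bigr => z _; rewrite wpoch_swap // swap_coefC.
rewrite -sumrB; apply: eq_bigr => z _; rewrite -scalerBl; congr (_ *: _); ring.
Qed.

Variable ev : A -> F.
Hypothesis ev_linear : forall a f g, ev (a *: f + g) = a * ev f + ev g.
Hypothesis evM : forall f g, ev (f * g) = ev f * ev g.
Hypothesis evX : forall i, ev (X i) = 1.
Hypothesis ev_act : forall s f, ev (act s f) = ev f.
Hypothesis euler : forall eta, \sum_i ev (der i (G eta)) = (mpoly.mdeg eta)%:R * ev (G eta).

Lemma ev_sum (I : Type) (r : seq I) (Q : pred I) (f : I -> A) :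
  ev (\sum_(i <- r | Q i) f i) = \sum_(i <- r | Q i) ev (f i).
Proof. exact: (linear_sum_of (V := F^o) _ _ _ ev_linear). Qed.

Lemma evZ a f : ev (a *: f) = a * ev f.
Proof.
have ev0 : ev 0 = 0 by have := ev_linear (-1) 0 0; rewrite scaleN1r oppr0 addr0 mulN1r addNr.
by have := ev_linear a f 0; rewrite !addr0 ev0 addr0.
Qed.

Lemma evD f g : ev (f + g) = ev f + ev g.
Proof. by have := ev_linear 1 f g; rewrite scale1r mul1r. Qed.

(** By symmetry all partial derivatives agree at [(1, .., 1)], and Euler's identity gives their
    sum. *)
Lemma ev_der_jack_gen a m i : n.+1%:R * ev (der i (jack_gen a m)) = m%:R * ev (jack_gen a m).
Proof.
transitivity (\sum_j ev (der j (jack_gen a m))).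
  rewrite (eq_bigr (fun=> ev (der i (jack_gen a m)))) => [|j _].
    by rewrite sumr_const card_ord mulr_natl.
  by rewrite -(ev_act (tperm j i)) (act_der H) tpermL jack_gen_sym.
rewrite (eq_bigr (fun j => \sum_(z <- comps n.+1 m) wpoch a z * ev (der j (G z)))).
  rewrite exchange_big /= ev_sum mulr_sumr; apply: eq_big_seq => z.
  rewrite mem_comps => /eqP zm; rewrite -mulr_sumr euler zm evZ; ring.
move=> j _; rewrite /jack_gen.
have der_sum := linear_sum_of _ _ _ (der_linear H j); rewrite der_sum ev_sum.
apply: eq_bigr => z _; rewrite -evZ; congr ev.
have d0 : der j 0 = 0 by have := der_linear H j (-1) 0 0; rewrite !scaleN1r oppr0 addr0 addNr.
by rewrite -[wpoch a z *: G z]addr0 (der_linear H) d0 addr0.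
Qed.

(** By symmetry [T] acts as the derivative, so [X ord_max] times the last derivative of
    [jack_gen a m.+1] equals [m.+1] times the raised [(a + D ord0)] of [jack_gen a m]. At
    [(1, .., 1)] both sides are known from [ev_der_jack_gen]. *)
Lemma ev_jack_genS a m :
  ev (jack_gen a m.+1) = (n.+1%:R * a + m%:R) * ev (jack_gen a m).
Proof.
have e : X ord_max * der ord_max (jack_gen a m.+1)
   = m.+1%:R *: raise (a *: jack_gen a m + D ord0 (jack_gen a m)).
  rewrite -(dunkl_sym k H) => [|i]; last exact: jack_gen_sym.
  rewrite /jack_gen (linear_sum_of _ _ _ (dunkl_gen_linear _ H ord_max)) mulr_sumr.
  rewrite (eq_bigr (fun z => (wpoch a z * lower_coef z) *: G z)); last first.
    move=> z _; have T0 := dunkl_gen_linear k H ord_max (-1) 0 0.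
    have TZ c f : T ord_max (c *: f) = c *: T ord_max f.
      rewrite -[c *: f]addr0 (dunkl_gen_linear _ H).
      by move: T0; rewrite !scaleN1r oppr0 addr0 addNr => ->; rewrite addr0.
    by rewrite TZ -scalerAr lower_relation scalerA.
  rewrite (bigID (fun z : mpoly.multinom n.+1 => 0 < z ord_max)%N) /= [X in _ + X]big1 ?addr0.
    rewrite -big_filter -(perm_big _ (perm_comps_mraise n m)) big_map /=.
    rewrite (linear_sum_of _ _ _ (cherednik_linear k H ord0)) scaler_sumr -big_split /=.
    rewrite /raising (act_sum H) mulr_sumr scaler_sumr.
    apply: eq_big_seq => z; rewrite mem_comps => /eqP zm.
    rewrite -scalerA -raise_relation zm wpoch_mraise (cherednikZ _ H) GD.
    rewrite !scalerA -scalerDl (actZ H) -scalerAr /raising !scalerA; congr (_ *: _).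
    ring.
  by move=> z; rewrite -eqn0Ngt => /eqP z0; rewrite lower_coef_eq0 // mulr0 scale0r.
(* The [n] transpositions in [D ord0] fix [jack_gen a m] and cancel its constant [k (1 - n.+1)]. *)
have D0 : ev (D ord0 (jack_gen a m)) = ev (der ord0 (jack_gen a m)).
  rewrite /cherednik_gen (dunkl_sym k H) => [|i]; last exact: jack_gen_sym.
  rewrite (eq_bigr (fun=> jack_gen a m)) => [|i _]; last exact: jack_gen_sym.
  rewrite big_mkcond big_ord_recl /= add0r sumr_const card_ord !evD !evZ evM evX mul1r.
  by rewrite -scaler_nat evZ -natr1; ring.
have /(congr1 ev) := e; rewrite evM evX mul1r evZ /raising evM evX mul1r ev_act evD evZ D0 => e2.
have n0 : n.+1%:R != 0 :> F by rewrite pnatr_eq0.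
have m0 : m.+1%:R != 0 :> F by rewrite pnatr_eq0.
apply: (mulfI m0); rewrite -(ev_der_jack_gen a m.+1 ord_max) e2.
rewrite mulrCA; congr (_ * _); rewrite mulrDr ev_der_jack_gen; ring.
Qed.

Lemma ev_jack_gen a m : ev (jack_gen a m) = \prod_(l < m) (n.+1%:R * a + l%:R).
Proof.
elim: m => [|m IH]; last by rewrite ev_jack_genS IH big_ord_recr /= mulrC.
have ev1 : ev 1 = 1.
  by have := evM 1 (X ord0); rewrite mul1r evX mulr1 => <-.
rewrite big_ord0 -[RHS]ev1 -(expr0 e1) -Gsum; congr ev; apply: eq_big_seq => z.
rewrite mem_comps mpoly.mdeg_eq0 => /eqP ->; rewrite /wpoch big1 ?scale1r // => j _.
by rewrite big1 // => -[l]; rewrite mpoly.mnm0E.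
Qed.

End JackRecursion.

(** * Multivariate polynomials as a model of the abstract calculus *)

Section MpolyCalculus.
Variables (R : realType) (n : nat).
Local Notation C := (R[i]).
Local Notation P := (mpoly.mpoly n C).
Local Notation X := (@Xv R n).

Lemma msym_Xv (s : 'S_n) (i : 'I_n) : mpoly.msym s (X i) = X (s i).
Proof.
rewrite /Xv mpoly.msymX; congr (mpoly.mpolyX _ _); apply/mpoly.mnmP => j.
rewrite mpoly.mnmE !mpoly.mnm1E; congr nat_of_bool.
by apply/eqP/eqP => [->|<-]; rewrite ?permKV ?permK.
Qed.

Lemma mderiv_Xv (i j : 'I_n) : mpoly.mderiv i (X j) = (i == j)%:R.
Proof.
rewrite /Xv mpoly.mderivX mpoly.mnm1E eq_sym; case: eqVneq => [->|_].
  rewrite scale1r; have -> : mpoly.mnm_sub (mpoly.mnm1 j) (mpoly.mnm1 j) = mpoly.mnm0.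
    by apply/mpoly.mnmP => l; rewrite mpoly.mnmBE subnn mpoly.mnm0E.
  by rewrite mpoly.mpolyX0.
by rewrite scale0r.
Qed.

Lemma sub_Xv_neq0 (i j : 'I_n) : i != j -> X i - X j != 0.
Proof.
move=> ij; apply/eqP => /(congr1 (mpoly.meval (fun l => (l == i)%:R : C))).
rewrite mpoly.mevalB /Xv !mpoly.mevalXU mpoly.meval0 eqxx eq_sym (negPf ij) subr0.
by move/eqP; rewrite oner_eq0.
Qed.

Lemma mderiv_msym (s : 'S_n) (l : 'I_n) (f : P) :
  mpoly.msym s (mpoly.mderiv l f) = mpoly.mderiv (s l) (mpoly.msym s f).
Proof.
apply/mpoly.mpolyP => m.
rewrite mpoly.mcoeff_sym !mpoly.mcoeff_deriv mpoly.mcoeff_sym mpoly.mnmE.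
congr (mpoly.mcoeff _ f *+ _); apply/mpoly.mnmP => i.
by rewrite mpoly.mnmE !mpoly.mnmDE mpoly.mnmE !mpoly.mnm1E (inj_eq perm_inj).
Qed.

Lemma mpoly_subring_ind (Q : P -> Prop) :
  (forall c, Q (mpoly.mpolyC n c)) -> (forall i, Q (X i)) ->
  (forall f g, Q f -> Q g -> Q (f + g)) -> (forall f g, Q f -> Q g -> Q (f * g)) ->
  forall f, Q f.
Proof.
move=> QC QX QD QM; elim/mpoly.mpolyind => [|c m p _ _ Qp].
  by rewrite -mpoly.mpolyC0; apply: QC.
apply: (QD) => //; rewrite -mpoly.mul_mpolyC; apply: (QM) => //.
rewrite mpoly.mpolyXE_id; apply: big_ind => [||l _]; [|exact: (QM)|].
  by rewrite -mpoly.mpolyC1; apply: QC.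
elim: (m l) => [|d IH]; first by rewrite expr0 -mpoly.mpolyC1; apply: QC.
by rewrite exprS; apply: (QM) => //; exact: (QX l).
Qed.

(** So the default [0] in [ddiff] is never taken. Divisibility holds for constants and variables,
    and the twisted Leibniz rule carries it to products. *)
Lemma ddiff_exists (i j : 'I_n) (f : P) :
  exists g : P, (X i - X j) * g = f - sij i j f.
Proof.
elim/mpoly_subring_ind: f => [c|l|f g [f' ef] [g' eg]|f g [f' ef] [g' eg]].
- exists 0; rewrite mulr0 -[mpoly.mpolyC n c]mulr1 mpoly.mul_mpolyC.
  by rewrite /sij mpoly.msymZ mpoly.msym1 subrr.
- rewrite /sij msym_Xv; case: tpermP => [->|->|_ _].
  + by exists 1; rewrite mulr1.
  + by exists (-1); rewrite mulrN1 opprB.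
  + by exists 0; rewrite mulr0 subrr.
- by exists (f' + g'); rewrite mulrDr ef eg /sij mpoly.msymD opprD addrACA.
- exists (f * g' + f' * sij i j g).
  by rewrite (leibniz_difference ef eg) /sij mpoly.msymM.
Qed.

Lemma mpoly_dunkl_calculus :
  dunkl_calculus (A := P) X (@mpoly.msym n C) (@mpoly.mderiv n C) (@ddiff R n).
Proof.
split.
- by move=> s a f g; rewrite mpoly.msymD mpoly.msymZ.
- by move=> s f g; rewrite mpoly.msymM.
- by move=> s t f; rewrite mpoly.msymMm.
- by move=> f; rewrite mpoly.msym1m.
- exact: msym_Xv.
- by move=> l a f g; rewrite mpoly.mderivD mpoly.mderivZ.
- by move=> l f g; rewrite mpoly.mderivM.
- exact: mderiv_Xv.
- exact: mderiv_msym.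
- by move=> i j f g /sub_Xv_neq0 d0 e; apply: (mulfI d0).
- move=> i j f; rewrite /ddiff; case: pselect => [h|]; first exact: (projT2 (cid h)).
  by case; apply: ddiff_exists.
Qed.

End MpolyCalculus.

Section DunklOfCalculus.
Variables (R : realType) (n : nat) (k : R).
Local Notation C := (R[i]).
Local Notation kC := (real_complex R k).
Local Notation P := (mpoly.mpoly n C).
Local Notation Tgen := (dunkl_gen (A := P) kC (@mpoly.mderiv n C) (@ddiff R n)).
Local Notation Dgen :=
  (cherednik_gen (A := P) kC (@Xv R n) (@mpoly.msym n C) (@mpoly.mderiv n C) (@ddiff R n)).

Lemma sum_ordered_pairs (F : nzRingType) (V : lmodType F) (d : 'I_n -> 'I_n -> V) (l : 'I_n) :
  (forall i j, i != j -> d j i = - d i j) ->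
  \sum_(i < n) \sum_(j < n | (i < j)%N) ((i == l)%:R - (j == l)%:R) *: d i j
  = \sum_(i | i != l) d l i.
Proof.
move=> dC.
transitivity (\sum_(j < n | (l < j)%N) d l j - \sum_(i < n | (i < l)%N) d i l).
  rewrite (eq_bigr (fun i : 'I_n => \sum_(j < n | (i < j)%N) (i == l)%:R *: d i j
             - \sum_(j < n | (i < j)%N) (j == l)%:R *: d i j)); last first.
    by move=> i _; rewrite -sumrB; apply: eq_bigr => j _; rewrite scalerBl.
  rewrite sumrB; congr (_ - _).
    rewrite (bigD1 l) //= [X in _ + X]big1 ?addr0.
      by apply: eq_bigr => j _; rewrite eqxx scale1r.
    by move=> i /negPf ->; rewrite big1 // => j _; rewrite scale0r.
  rewrite [RHS]big_mkcond; apply: eq_bigr => i _; case: ifP => il.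
    rewrite (bigD1 l) //= eqxx scale1r big1 ?addr0 // => j /andP[_ /negPf ->].
    by rewrite scale0r.
  by rewrite big1 // => j ij; case: eqVneq ij => [->|]; rewrite ?il // scale0r.
rewrite [RHS](bigID (fun i : 'I_n => (l < i)%N)) /=; congr (_ + _).
  by apply: eq_bigl => i; rewrite -val_eqE /=; case: ltngtP.
rewrite -sumrN; apply: eq_big => [i|i il].
  by rewrite -val_eqE /=; case: ltngtP.
by rewrite dC ?opprK // -val_eqE /= gtn_eqF.
Qed.

Lemma dunkljE (l : 'I_n) (f : P) : dunklj k l f = Tgen l f.
Proof.
rewrite /dunklj /dunkl /dunkl_gen; congr (_ + _ *: _).
  by rewrite (bigD1 l) //= eqxx scale1r big1 ?addr0 // => j /negPf ->; rewrite scale0r.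
apply: (sum_ordered_pairs (d := fun i j => ddiff i j f)) => i j ij.
have H := mpoly_dunkl_calculus R n.
apply: (dd_eq H); first by rewrite eq_sym.
by rewrite mulrN -mulNr opprB (ddP H) tpermC.
Qed.

Lemma DopE (j : 'I_n) (f : P) : Dop k j f = Dgen j f.
Proof.
have E : \sum_(i < n | (j < i)%N) sij i j f = \sum_(i < n | (j < i)%N) sij j i f.
  by apply: eq_bigr => i _; rewrite /sij tpermC.
by rewrite /Dop dunkljE E.

Qed.

(** The two counts in [ebar] split the indices preceding [j] into those to the left and those to the
    right of [j]. *)
Lemma ebarE (eta : mpoly.multinom n) (j : 'I_n) : ebar k eta j = eb kC eta j.
Proof.
rewrite /ebar /eb -addrA -opprD -mulrDr -natrD; congr (_ - _ * _%:R).
rewrite /crank -(cardsID [set i : 'I_n | (i < j)%N]%SET).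
congr (_ + _)%N; apply: eq_card => i; rewrite !inE /precedes.
  by apply/asboolP/idP => /=; lia.
by apply/asboolP/idP => /=; case: (eqVneq i j) => [->|]; rewrite -?val_eqE /=; lia.
Qed.

Lemma gpoch_eplus (a : C) (eta : mpoly.multinom n) :
  gpoch k a (eplus eta) = \prod_j poch (a - kC * (crank eta j)%:R) (eta j).
Proof.
rewrite /gpoch (reindex_inj (@crank_ord_inj _ eta)) /=.
by apply: eq_bigr => j _; rewrite eplus_crank.
Qed.

End DunklOfCalculus.

(** * Polynomials determined by their values; homogeneous polynomials with nonnegative
    coefficients *)

Lemma expansion_inj (N n : nat) (f g : 'I_n -> nat) :
  (forall i, f i < N)%N -> (forall i, g i < N)%N ->
  (\sum_i f i * N ^ i = \sum_i g i * N ^ i)%N -> f =1 g.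
Proof.
elim: n f g => [|n IH] f g fN gN; first by move=> _ [].
rewrite !big_ord_recl /= !expn0 !muln1.
have shift (h : 'I_n.+1 -> nat) :
    (\sum_(i < n) h (lift ord0 i) * N ^ lift ord0 i = (\sum_(i < n) h (lift ord0 i) * N ^ i) * N)%N.
  by rewrite big_distrl /=; apply: eq_bigr => i _; rewrite expnSr mulnA.
rewrite !shift => e.
have e0 : f ord0 = g ord0.
  by have := congr1 (modn^~ N) e; rewrite /= ![(_ ord0 + _)%N]addnC !modnMDl !modn_small.
move: e; rewrite e0 => /addnI/eqP; rewrite eqn_pmul2r; last first.
  by apply: leq_ltn_trans (fN ord0).
move=> /eqP/(IH (fun i => f (lift ord0 i)) (fun i => g (lift ord0 i))) e1 i.
by case: (unliftP ord0 i) => [j|] ->; rewrite ?e0 // e1.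
Qed.

(* Kronecker substitution: [x_i := t ^ (N ^ i)] separates the monomials. *)
Lemma mpoly_meval_eq0 (R : numFieldType) (n : nat) (p : mpoly.mpoly n R) :
  (forall z, mpoly.meval z p = 0) -> p = 0.
Proof.
move=> ev0; pose N := mpoly.msize p.
pose code (m : mpoly.multinom n) := (\sum_i m i * N ^ i)%N.
pose q : {poly R} := \sum_(m <- mpoly.msupp p) mpoly.mcoeff m p *: 'X^(code m).
have q0 : q = 0.
  apply: (@roots_geq_poly_eq0 _ _ [seq i%:R | i <- iota 0 (size q)]).
  - apply/allP => _ /mapP[i _ ->]; rewrite rootE /q horner_sum -[X in _ == X](ev0 (fun j => i%:R ^+ (N ^ j))).
    rewrite mpoly.mevalE; apply/eqP/eq_bigr => m _; rewrite !hornerE; congr (_ * _).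
    by rewrite /code expr_sum; apply: eq_bigr => j _; rewrite -exprM mulnC.
  - by rewrite map_inj_uniq ?iota_uniq // => a b /eqP; rewrite eqr_nat => /eqP.
  - by rewrite size_map size_iota.
apply/mpoly.mpolyP => m; rewrite mpoly.mcoeff0.
have [ms|/mpoly.memN_msupp_eq0 //] := boolP (m \in mpoly.msupp p).
have lt (m' : mpoly.multinom n) i : m' \in mpoly.msupp p -> (m' i < N)%N.
  move=> /mpoly.msize_mdeg_lt; apply: leq_ltn_trans.
  by rewrite mpoly.mdegE (bigD1 i) //= leq_addr.
have := congr1 (fun r : {poly R} => r`_(code m)) q0; rewrite coef0 /q coef_sum.
rewrite (bigD1_seq m) ?mpoly.msupp_uniq //= coefZ coefXn eqxx mulr1 big_seq_cond big1 ?addr0 //.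
move=> m' /andP[m's ne]; rewrite coefZ coefXn; case: eqP => [ce|]; last by rewrite mulr0.
case/eqP: ne; apply/mpoly.mnmP => i.
have := @expansion_inj N n (fun i => m' i) (fun i => m i); apply=> // j; exact: lt.
Qed.

(** In a numeric field [0 <=] includes being real. The property survives every construction in
    [jack_ind] and makes the value at [(1, .., 1)] the sum of the moduli of the coefficients. *)
Definition nonneg_homog (F : numFieldType) (n m : nat) (f : mpoly.mpoly n F) : Prop :=
  (forall mu, 0 <= mpoly.mcoeff mu f) /\ (forall mu, mpoly.mdeg mu != m -> mpoly.mcoeff mu f = 0).

Section NonnegHomog.
Variables (F : numFieldType) (n : nat).
Implicit Types f g : mpoly.mpoly n F.

Lemma nonneg_homog1 : nonneg_homog 0 (1 : mpoly.mpoly n F).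
Proof.
split=> mu; rewrite mpoly.mcoeff1; first by rewrite ler0n.
by rewrite mpoly.mdeg_eq0 => /negPf ->.
Qed.

Lemma nonneg_homog_msym m s f : nonneg_homog m f -> nonneg_homog m (mpoly.msym s f).
Proof.
move=> [f0 fm]; split=> mu; rewrite mpoly.mcoeff_sym => // ne.
by apply: fm; rewrite -[mpoly.Multinom _]/(mact s mu) mdeg_mact.
Qed.

Lemma nonneg_homogMX m i f : nonneg_homog m f ->
  nonneg_homog m.+1 (mpoly.mpolyX F (mpoly.mnm1 i) * f).
Proof.
move=> [f0 fm]; split=> mu; rewrite mpoly.mcoeffM.
  by apply: sumr_ge0 => a _; rewrite mulr_ge0 // mpoly.mcoeffX ler0n.
move=> ne; apply: big1 => a /eqP e; rewrite mpoly.mcoeffX; case: eqP => [ea|]; last by rewrite mul0r.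
rewrite fm ?mulr0 //; apply/eqP => em; case/eqP: ne.
by have := congr1 (@mpoly.mdeg n) e; rewrite mpoly.mdegD -ea mpoly.mdeg1 em add1n.
Qed.

Lemma nonneg_homogD m f g : nonneg_homog m f -> nonneg_homog m g -> nonneg_homog m (f + g).
Proof.
move=> [f0 fm] [g0 gm]; split=> mu; rewrite mpoly.mcoeffD; first by rewrite addr_ge0.
by move=> ne; rewrite fm // gm // addr0.
Qed.

Lemma nonneg_homogZ m c f : 0 <= c -> nonneg_homog m f -> nonneg_homog m (c *: f).
Proof.
move=> c0 [f0 fm]; split=> mu; rewrite mpoly.mcoeffZ; first by rewrite mulr_ge0.
by move=> ne; rewrite fm // mulr0.
Qed.

Lemma nonneg_homog0 m : nonneg_homog m (0 : mpoly.mpoly n F).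
Proof. by split=> mu; rewrite mpoly.mcoeff0. Qed.

Lemma meval1_mpolyX (mu : mpoly.multinom n) : mpoly.meval (fun=> 1) (mpoly.mpolyX F mu) = 1.
Proof. by rewrite mpoly.mevalX big1 // => j _; rewrite expr1n. Qed.

Lemma mderiv_euler m f : nonneg_homog m f ->
  \sum_i mpoly.meval (fun=> 1) (mpoly.mderiv i f) = m%:R * mpoly.meval (fun=> 1) f.
Proof.
move=> [_ fm]; rewrite [f in RHS]mpoly.mpolyE {1}[f]mpoly.mpolyE.
rewrite (eq_bigr (fun i => \sum_(mu <- mpoly.msupp f) (mu i)%:R * mpoly.mcoeff mu f)).
  rewrite exchange_big /= raddf_sum /= mulr_sumr; apply: eq_big_seq => mu mus.
  rewrite mpoly.mevalZ meval1_mpolyX mulr1.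
  rewrite -mulr_suml -natr_sum -mpoly.mdegE; congr (_%:R * _).
  apply/eqP/negPn/negP => /fm e; move: mus; rewrite mpoly.mcoeff_msupp e eqxx //.
move=> i _; have lin a (x y : mpoly.mpoly n F) :
    mpoly.mderiv i (a *: x + y) = a *: mpoly.mderiv i x + mpoly.mderiv i y.
  by rewrite mpoly.mderivD mpoly.mderivZ.
rewrite (linear_sum_of _ _ _ lin) raddf_sum; apply: eq_bigr => mu _ /=.
by rewrite mpoly.mderivZ mpoly.mderivX !mpoly.mevalZ meval1_mpolyX mulr1 mulrC.
Qed.

End NonnegHomog.

(** * Positivity and weighted sums of the polynomials [Ljack] *)

Section JackPolynomials.
Variables (R : realType) (k : R).
Hypothesis k0 : 0 <= k.
Local Notation C := (R[i]).
Local Notation kC := (real_complex R k).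

Lemma Ljack_eigen n (eta : mpoly.multinom n) j : Dop k j (Ljack k eta) = eb kC eta j *: Ljack k eta.
Proof.
have H := mpoly_dunkl_calculus R n.
rewrite DopE /Ljack (cherednikZ _ H) -DopE scalerA [eb _ _ _ * _]mulrC -scalerA; congr (_ *: _).
rewrite /Ejack; case: pselect => [h|_]; first by rewrite -ebarE; case: (projT2 (cid h)).
(* If no [E eta] exists, the default [0] still satisfies the eigenvalue equation. *)
rewrite scaler0 DopE; have := cherednikZ kC H j 0 0; by rewrite !scale0r.
Qed.

(** The left case is the default of [cjack]. In the right case the identity is given pointwise, and
    a polynomial vanishing at all points is zero. *)
Lemma Ljack_sum n : (forall eta : mpoly.multinom n, Ljack k eta = 0) \/
  (forall m, \sum_(eta <- comps n m) Ljack k eta = (\sum_i Xv R i) ^+ m).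
Proof.
rewrite /Ljack /cjack; case: pselect => [h|_]; last by left=> eta; rewrite scale0r.
right=> m; apply/eqP; rewrite -subr_eq0; apply/eqP/mpoly_meval_eq0 => z.
apply/eqP; rewrite mpoly.mevalB subr_eq0; apply/eqP.
rewrite rmorphXn !raddf_sum /=.
rewrite [in RHS](eq_bigr z) => [|i _]; last by rewrite /Xv mpoly.mevalXU.
rewrite -big_comps (projT2 (cid h)); apply: eq_bigr => e _.
by rewrite mpoly.mevalZ.
Qed.

Lemma multinom0 (eta : mpoly.multinom 0) : eta = mpoly.mnm0.
Proof. by apply/mpoly.mnmP => -[]. Qed.

Lemma comps0 n : comps n 0 = [:: mpoly.mnm0].
Proof.
apply: perm_small_eq => //; apply: uniq_perm; rewrite ?comps_uniq // => eta.
by rewrite mem_comps mem_seq1 mpoly.mdeg_eq0.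
Qed.

Lemma Ljack_nonneg_homog n (eta : mpoly.multinom n) : nonneg_homog (mpoly.mdeg eta) (Ljack k eta).
Proof.
have [-> //|Gsum] := Ljack_sum n; first exact: nonneg_homog0.
case: n Gsum eta => [|n] Gsum eta.
  have := Gsum 0%N; rewrite comps0 big_seq1 expr0 (multinom0 eta) mpoly.mdeg0 => ->.
  exact: nonneg_homog1.
have GD z j : cherednik_gen kC (@Xv R n.+1) (@mpoly.msym n.+1 C) (@mpoly.mderiv n.+1 C) (@ddiff R n.+1)
   j (Ljack k z) = eb kC z j *: Ljack k z by rewrite -DopE Ljack_eigen.
have k0C : 0 <= kC by rewrite lecR.
apply: (jack_ind k0C (mpoly_dunkl_calculus R n.+1) GD Gsum (P := fun m f => nonneg_homog m f)).
- exact: nonneg_homog1.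
- by move=> m s f; apply: nonneg_homog_msym.
- by move=> m i f; apply: nonneg_homogMX.
- by move=> m f g; apply: nonneg_homogD.
- by move=> m c f; apply: nonneg_homogZ.
Qed.

Lemma Ljack_weighted_sum n : (forall eta : mpoly.multinom n, Ljack k eta = 0) \/
  (forall a m, \sum_(eta <- comps n m) gpoch k a (eplus eta) * mpoly.meval (fun=> 1) (Ljack k eta)
    = \prod_(l < m) (n%:R * a + l%:R)).
Proof.
have [|Gsum] := Ljack_sum n; [by left|right=> a m].
case: n Gsum => [|n] Gsum.
  (* Without variables there is no composition of positive degree, and the product then contains the
     factor [0]. *)
  case: m => [|m].
    have := Gsum 0%N; rewrite comps0 !big_seq1 expr0 big_ord0 => ->.
    by rewrite mpoly.meval1 mulr1 /gpoch big_ord0.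
  rewrite big_ord_recl mul0r addr0 mul0r big_seq big1 // => eta.
  by rewrite mem_comps (multinom0 eta) mpoly.mdeg0.
have GD z j : cherednik_gen kC (@Xv R n.+1) (@mpoly.msym n.+1 C) (@mpoly.mderiv n.+1 C) (@ddiff R n.+1)
   j (Ljack k z) = eb kC z j *: Ljack k z by rewrite -DopE Ljack_eigen.
have k0C : 0 <= kC by rewrite lecR.
rewrite -(ev_jack_gen k0C (mpoly_dunkl_calculus R n.+1) GD Gsum (ev := mpoly.meval (fun=> 1))).
- rewrite /jack_gen raddf_sum /=; apply: eq_bigr => eta _.
  rewrite [RHS]mpoly.mevalZ gpoch_eplus /wpoch; congr (_ * _).
- by move=> b f g; rewrite mpoly.mevalD mpoly.mevalZ.
- by move=> f g; rewrite mpoly.mevalM.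
- by move=> i; rewrite /Xv mpoly.mevalXU.
- move=> s f; rewrite -[mpoly.msym s f]/(mpoly.mmap _ _ _).
  elim/mpoly_subring_ind: f => [c|i|f g ef eg|f g ef eg].
  + rewrite -[mpoly.mpolyC _ c]mulr1 mpoly.mul_mpolyC -[mpoly.mmap _ _ _]/(mpoly.msym s _).
    by rewrite mpoly.msymZ mpoly.msym1.
  + by rewrite -[mpoly.mmap _ _ _]/(mpoly.msym s _) msym_Xv /Xv !mpoly.mevalXU.
  + rewrite -[mpoly.mmap _ _ _]/(mpoly.msym s _) mpoly.msymD !mpoly.mevalD; congr (_ + _); [exact: ef|exact: eg].
  + rewrite -[mpoly.mmap _ _ _]/(mpoly.msym s _) mpoly.msymM !mpoly.mevalM; congr (_ * _); [exact: ef|exact: eg].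
- by move=> eta; apply: mderiv_euler; apply: Ljack_nonneg_homog.
Qed.

End JackPolynomials.

Import numFieldNormedType.Exports.

(** * Complex moduli and series *)

Section ComplexNorm.
Variable R : realType.
Implicit Types z w : R[i].
Local Notation nm := (@Normc.normc R).

Lemma nm_normr z : `|z| = (nm z)%:C%C.
Proof. by []. Qed.

Lemma nm_ge0 z : 0 <= nm z.
Proof. by case: z => a b; rewrite sqrtr_ge0. Qed.

Lemma nmD z w : nm (z + w) <= nm z + nm w.
Proof. exact: le_normcD. Qed.

Lemma nmN z : nm (- z) = nm z.
Proof. exact: normcN. Qed.

Lemma nmB z w : nm (z - w) = nm (w - z).
Proof. by rewrite -nmN opprB. Qed.

Lemma nmM z w : nm (z * w) = nm z * nm w.
Proof. exact: Normc.normcM. Qed.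

Lemma nmV z : nm z^-1 = (nm z)^-1.
Proof. exact: Normc.normcV. Qed.

Lemma nm0 : nm 0 = 0.
Proof. exact: Normc.normc0. Qed.

Lemma nm1 : nm 1 = 1.
Proof. exact: Normc.normc1. Qed.

Lemma nm_gt0 z : z != 0 -> 0 < nm z.
Proof.
move=> z0; rewrite lt_neqAle nm_ge0 andbT eq_sym; apply: contra z0 => /eqP.
by move=> /(@Normc.eq0_normc R) ->.
Qed.

Lemma nm_real (r : R) : nm r%:C%C = `|r|.
Proof. by rewrite /= expr0n /= addr0 sqrtr_sqr. Qed.

Lemma nm_nat (m : nat) : nm m%:R = m%:R.
Proof. by rewrite -(rmorph_nat (real_complex R)) nm_real ger0_norm. Qed.

Lemma nmX z m : nm (z ^+ m) = nm z ^+ m.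
Proof. by elim: m => [|m IH]; rewrite ?expr0 ?nm1 // !exprS nmM IH. Qed.

Lemma nm_sum (I : Type) (r : seq I) (P : pred I) (f : I -> R[i]) :
  nm (\sum_(i <- r | P i) f i) <= \sum_(i <- r | P i) nm (f i).
Proof.
elim/big_ind2: _ => [|x1 x2 y1 y2 h1 h2|//]; first by rewrite nm0.
by apply: le_trans (nmD _ _) _; apply: lerD.
Qed.

Lemma ler_nmB z w : nm z - nm w <= nm (z - w).
Proof. by rewrite lerBlDr -{1}(subrK w z) nmD. Qed.

Lemma nm_ge_part z : `|complex.Re z| <= nm z /\ `|complex.Im z| <= nm z.
Proof.
case: z => a b /=; split; rewrite -[leLHS]sqrtr_sqr ler_wsqrtr //.
  by rewrite lerDl sqr_ge0.
by rewrite lerDr sqr_ge0.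
Qed.

Lemma nm_le_parts z : nm z <= `|complex.Re z| + `|complex.Im z|.
Proof.
rewrite {1}[z]complexE; apply: le_trans (nmD _ _) _; rewrite nmM !nm_real.
by rewrite (_ : nm 'i%C = 1) ?mul1r //= expr0n expr1n /= add0r sqrtr1.
Qed.

End ComplexNorm.

Section ComplexSeries.
Variable R : realType.
Implicit Types (b c : nat -> R[i]) (S : R[i]) (A s : R).
Local Notation nm := (@Normc.normc R).

(** Convergence with real tolerances keeps all estimates in [R]; [csums_cvg] translates back to
    limits along filters. *)
Definition csums b S : Prop :=
  forall e : R, 0 < e -> exists N, forall M, (N <= M)%N -> nm (\sum_(m < M) b m - S) <= e.

Lemma csums_cvg b S : csums b S -> (fun M => (\sum_(m < M) b m : R[i]^o)) @ \oo --> (S : R[i]^o).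
Proof.
move=> bS; apply/cvgrPdist_le => -[e e'] /=; rewrite ltcE /= => /andP[/eqP -> e0].
have [N bN] := bS e e0; exists N => // M /= NM.
by rewrite distrC nm_normr lecR bN.
Qed.

Lemma eq_csums b c S : b =1 c -> csums b S -> csums c S.
Proof. by move=> /funext ->. Qed.

Lemma csumsD b c S S' : csums b S -> csums c S' -> csums (fun m => b m + c m) (S + S').
Proof.
move=> bS cS e e0; have e2 : 0 < e / 2 by lra.
have [N bN] := bS _ e2; have [N' cN] := cS _ e2; exists (maxn N N') => M; rewrite geq_max.
move=> /andP[/bN h1 /cN h2]; rewrite big_split /= opprD addrACA.
by apply: le_trans (nmD _ _) _; lra.
Qed.

Lemma csumsZ b S (a : R[i]) : csums b S -> csums (fun m => a * b m) (a * S).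
Proof.
move=> bS e e0; have a0 : 0 < nm a + 1 by rewrite ltr_wpDl ?nm_ge0.
have [N bN] := bS (e / (nm a + 1)) (divr_gt0 e0 a0); exists N => M /bN.
rewrite -mulr_sumr -mulrBr nmM ler_pdivlMr // => h; apply: le_trans h.
by rewrite mulrC ler_wpM2l ?nm_ge0 // lerDl.
Qed.

Lemma csums0 : csums (fun=> 0) 0.
Proof. by move=> e /ltW e0; exists 0%N => M _; rewrite big1 // subrr nm0. Qed.

Lemma csums_sum (I : Type) (r : seq I) (f : I -> nat -> R[i]) (F : I -> R[i]) :
  (forall i, csums (f i) (F i)) ->
  csums (fun m => \sum_(i <- r) f i m) (\sum_(i <- r) F i).
Proof.
move=> fF; elim: r => [|i r IH].
  by rewrite big_nil; apply: eq_csums csums0 => m; rewrite big_nil.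
by rewrite big_cons; apply: eq_csums (csumsD (fF i) IH) => m; rewrite big_cons.
Qed.

Lemma geometric_partial_le s M : 0 <= s < 1 -> \sum_(m < M) s ^+ m <= (1 - s)^-1.
Proof.
move=> /andP[s0 s1]; have d : 0 < 1 - s by rewrite subr_gt0.
rewrite -[leRHS]mul1r ler_pdivlMr //.
have -> : (\sum_(m < M) s ^+ m) * (1 - s) = 1 - s ^+ M by rewrite -[RHS]opprB subrX1; ring.
by rewrite lerBlDr lerDl exprn_ge0.
Qed.

Lemma real_series_cvg (u : nat -> R) A s : 0 <= s < 1 -> (forall m, `|u m| <= A * s ^+ m) ->
  exists l, forall e, 0 < e -> exists N, forall M, (N <= M)%N -> `|\sum_(m < M) u m - l| <= e.
Proof.
move=> /andP[s0 s1] uA; have A0 : 0 <= A by have := le_trans (normr_ge0 _) (uA 0%N); rewrite mulr1.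
have c : cvgn (series u).
  apply: normed_cvg; apply: (series_le_cvg (v_ := geometric A s)) => [m|m|m|].
  - exact: normr_ge0.
  - by rewrite /= mulr_ge0 ?exprn_ge0.
  - exact: uA.
  - by apply: is_cvg_geometric_series; rewrite ger0_norm.
exists (limn (series u)) => e e0; move/cvgrPdist_le: (c) => /(_ e e0)[N _ h].
by exists N => M NM; have := h M NM; rewrite distrC /series /= big_mkord.
Qed.

Lemma csums_exists b A s : 0 <= s < 1 -> (forall m, nm (b m) <= A * s ^+ m) -> exists S, csums b S.
Proof.
move=> s01 bA.
have [x hx] := real_series_cvg s01 (fun m => le_trans (proj1 (nm_ge_part (b m))) (bA m)).
have [y hy] := real_series_cvg s01 (fun m => le_trans (proj2 (nm_ge_part (b m))) (bA m)).
exists (x +i* y)%C => e e0; have e2 : 0 < e / 2 by lra.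
have [N hN] := hx _ e2; have [N' hN'] := hy _ e2; exists (maxn N N') => M; rewrite geq_max.
move=> /andP[/hN h1 /hN' h2]; apply: le_trans (nm_le_parts _) _.
have ReS : complex.Re (\sum_(m < M) b m) = \sum_(m < M) complex.Re (b m).
  by apply: (big_morph (@complex.Re R)) => // -[? ?] [? ?].
have ImS : complex.Im (\sum_(m < M) b m) = \sum_(m < M) complex.Im (b m).
  by apply: (big_morph (@complex.Im R)) => // -[? ?] [? ?].
have -> : complex.Re (\sum_(m < M) b m - (x +i* y)%C) = \sum_(m < M) complex.Re (b m) - x.
  by rewrite -ReS; case: (\sum_(m < M) b m).
have -> : complex.Im (\sum_(m < M) b m - (x +i* y)%C) = \sum_(m < M) complex.Im (b m) - y.
  by rewrite -ImS; case: (\sum_(m < M) b m).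
by lra.
Qed.

Lemma csums_le b S A s : 0 <= s < 1 -> (forall m, nm (b m) <= A * s ^+ m) -> csums b S ->
  nm S <= A / (1 - s).
Proof.
move=> s01 bA bS; have A0 : 0 <= A by have := le_trans (nm_ge0 _) (bA 0%N); rewrite mulr1.
apply/ler_addgt0Pr => e e0; have [N bN] := bS e e0.
have h1 := bN N (leqnn N); set P := \sum_(m < N) b m in h1.
have h2 : nm P <= A / (1 - s).
  apply: le_trans (nm_sum _ _ _) _.
  apply: (le_trans (y := \sum_(m < N) A * s ^+ m)); first by apply: ler_sum => m _; apply: bA.
  by rewrite -mulr_sumr ler_wpM2l // geometric_partial_le.
have : nm S <= nm P + nm (P - S).
  by rewrite [nm (P - S)]nmB addrC -{1}(subrK P S) nmD.
by lra.
Qed.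

End ComplexSeries.

(** * First-order expansions with quadratic remainder *)

Section Jets.
Variables (R : realType) (N : nat).
Implicit Types (x y : 'I_N -> R[i]) (d r M : R) (f g : ('I_N -> R[i]) -> R[i]).
Local Notation nm := (@Normc.normc R).

Definition lin_part x (f1 : 'I_N -> R[i]) y : R[i] := \sum_i (y i - x i) * f1 i.

(* [M] bounds a first-order Taylor expansion of [f] at [x] on the polydisc of radius [d];
   the least such [M] is submultiplicative in [f]. *)
Definition jet d x f M : Prop :=
  exists (f0 : R[i]) (f1 : 'I_N -> R[i]) (rho : R),
    [/\ 0 <= rho, nm f0 + d * (\sum_i nm (f1 i)) + rho <= M &
     forall y r, 0 <= r <= 1 -> (forall i, nm (y i - x i) <= d * r) ->
       nm (f y - f0 - lin_part x f1 y) <= rho * r ^+ 2].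

Lemma lin_part_le d x (f1 : 'I_N -> R[i]) y r : 0 <= d -> (forall i, nm (y i - x i) <= d * r) ->
  nm (lin_part x f1 y) <= d * (\sum_i nm (f1 i)) * r.
Proof.
move=> d0 h; apply: le_trans (nm_sum _ _ _) _.
rewrite mulrAC mulr_sumr; apply: ler_sum => i _.
by rewrite nmM ler_wpM2r ?nm_ge0.
Qed.

Lemma jet_ge0 d x f M : 0 <= d -> jet d x f M -> 0 <= M.
Proof.
move=> d0 [f0 [f1 [rho [rho0 le _]]]]; apply: le_trans le.
by rewrite !addr_ge0 ?nm_ge0 // mulr_ge0 // sumr_ge0 // => i _; apply: nm_ge0.
Qed.

Lemma jet_le d x f M M' : M <= M' -> jet d x f M -> jet d x f M'.
Proof.
move=> MM [f0 [f1 [rho [rho0 le h]]]]; exists f0, f1, rho; split=> //.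
exact: le_trans MM.
Qed.

Lemma jet_bound d x f M : 0 <= d -> jet d x f M ->
  forall y, (forall i, nm (y i - x i) <= d) -> nm (f y) <= M.
Proof.
move=> d0 [f0 [f1 [rho [rho0 le h]]]] y yx.
have yx1 i : nm (y i - x i) <= d * 1 by rewrite mulr1.
have h1 := h y 1 (introT andP (conj ler01 (lexx _))) yx1.
have h2 := lin_part_le f1 d0 yx1.
rewrite expr1n mulr1 in h1; rewrite mulr1 in h2.
have e : f y = (f y - f0 - lin_part x f1 y) + (f0 + lin_part x f1 y) by ring.
have := nmD f0 (lin_part x f1 y); have := nmD (f y - f0 - lin_part x f1 y) (f0 + lin_part x f1 y).
rewrite -e; lra.
Qed.

Lemma eq_jet d x f g M : f =1 g -> jet d x f M -> jet d x g M.
Proof. by move=> /funext ->. Qed.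

Lemma jet_cst d x (c : R[i]) : jet d x (fun=> c) (nm c).
Proof.
exists c, (fun=> 0), 0; split=> //.
  by rewrite big1 ?mulr0 ?addr0 // => i _; rewrite nm0.
move=> y r _ _; rewrite subrr /lin_part big1 ?subr0 ?nm0 ?mul0r // => i _.
by rewrite mulr0.
Qed.

Lemma jet_coord d x i : jet d x (fun y => y i) (nm (x i) + d).
Proof.
exists (x i), (fun j => (j == i)%:R), 0; split=> //.
  rewrite addr0 lerD2l (bigD1 i) //= eqxx nm1 big1 ?addr0 ?mulr1 // => j /negPf ->.
  by rewrite nm0.
move=> y r _ _; rewrite /lin_part (bigD1 i) //= eqxx mulr1 big1.
  by rewrite addr0 subrr nm0 mul0r.
by move=> j /negPf ->; rewrite mulr0.
Qed.

Lemma jetD d x f g M M' : 0 <= d -> jet d x f M -> jet d x g M' -> jet d x (fun y => f y + g y) (M + M').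
Proof.
move=> d0 [f0 [f1 [rf [rf0 lef hf]]]] [g0 [g1 [rg [rg0 leg hg]]]].
exists (f0 + g0), (fun i => f1 i + g1 i), (rf + rg); split.
- by rewrite addr_ge0.
- have h1 := nmD f0 g0.
  have : d * (\sum_i nm (f1 i + g1 i)) <= d * (\sum_i nm (f1 i)) + d * (\sum_i nm (g1 i)).
    by rewrite -mulrDr ler_wpM2l // -big_split; apply: ler_sum => i _; apply: nmD.
  by lra.
- move=> y r r01 yx; have := hf y r r01 yx; have := hg y r r01 yx.
  have -> : f y + g y - (f0 + g0) - lin_part x (fun i => f1 i + g1 i) y
    = (f y - f0 - lin_part x f1 y) + (g y - g0 - lin_part x g1 y).
    have -> : lin_part x (fun i => f1 i + g1 i) y = lin_part x f1 y + lin_part x g1 y.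
      by rewrite /lin_part -big_split; apply: eq_bigr => i _; rewrite mulrDr.
    ring.
  move=> h1 h2; apply: le_trans (nmD _ _) _; rewrite mulrDl; lra.
Qed.

Lemma jetM d x f g M M' : 0 <= d -> jet d x f M -> jet d x g M' ->
  jet d x (fun y => f y * g y) (M * M').
Proof.
move=> d0 [f0 [f1 [rf [rf0 lef hf]]]] [g0 [g1 [rg [rg0 leg hg]]]].
set bf := d * (\sum_i nm (f1 i)) in lef; set bg := d * (\sum_i nm (g1 i)) in leg.
have bf0 : 0 <= bf by rewrite mulr_ge0 // sumr_ge0 // => i _; apply: nm_ge0.
have bg0 : 0 <= bg by rewrite mulr_ge0 // sumr_ge0 // => i _; apply: nm_ge0.
have nf0 := nm_ge0 f0; have ng0 := nm_ge0 g0.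
exists (f0 * g0), (fun i => f0 * g1 i + g0 * f1 i).
(* Bounds for the four products of order two or higher: [f0 eg], [Lf Lg], [Lf eg] and [ef] times the
   whole of [g]. They all occur in the expansion of [(nm f0 + bf + rf) * (nm g0 + bg + rg)], so no
   constant is lost. *)
exists (nm f0 * rg + bf * bg + bf * rg + rf * (nm g0 + bg + rg)); split.
- have p1 := mulr_ge0 nf0 rg0; have p2 := mulr_ge0 bf0 bg0; have p3 := mulr_ge0 bf0 rg0.
  have p4 := mulr_ge0 rf0 (addr_ge0 (addr_ge0 ng0 bg0) rg0).
  exact: addr_ge0 (addr_ge0 (addr_ge0 p1 p2) p3) p4.
- have sle : d * (\sum_i nm (f0 * g1 i + g0 * f1 i)) <= nm f0 * bg + nm g0 * bf.
    rewrite /bf /bg ![nm _ * (d * _)]mulrCA -mulrDr ler_wpM2l // !mulr_sumr -big_split /=.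
    by apply: ler_sum => i _; apply: le_trans (nmD _ _) _; rewrite !nmM.
  have := ler_pM (addr_ge0 (addr_ge0 nf0 bf0) rf0) (addr_ge0 (addr_ge0 ng0 bg0) rg0) lef leg.
  rewrite nmM => le; apply: le_trans le; rewrite -subr_ge0.
  rewrite -subr_ge0 in sle; move: sle; set X := d * _.
  suff -> : (nm f0 + bf + rf) * (nm g0 + bg + rg) -
    (nm f0 * nm g0 + X + (nm f0 * rg + bf * bg + bf * rg + rf * (nm g0 + bg + rg)))
     = nm f0 * bg + nm g0 * bf - X by [].
  ring.
move=> y r r01 yx; have hf' := hf y r r01 yx; have hg' := hg y r r01 yx.
have lf := lin_part_le f1 d0 yx; have lg := lin_part_le g1 d0 yx.
rewrite -/bf in lf; rewrite -/bg in lg; case/andP: r01 => r0 r1.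
set Lf := lin_part x f1 y in hf' lf; set Lg := lin_part x g1 y in hg' lg.
set ef := f y - f0 - Lf in hf'; set eg := g y - g0 - Lg in hg'.
have -> : f y * g y - f0 * g0 - lin_part x (fun i => f0 * g1 i + g0 * f1 i) y
   = f0 * eg + Lf * Lg + Lf * eg + ef * (g0 + Lg + eg).
  have -> : lin_part x (fun i => f0 * g1 i + g0 * f1 i) y = f0 * Lg + g0 * Lf.
    rewrite /lin_part /Lg /Lf /lin_part !mulr_sumr -big_split; apply: eq_bigr => i _ /=.
    ring.
  rewrite /ef /eg; ring.
have r2 : 0 <= r ^+ 2 by rewrite sqr_ge0.
have rr : r ^+ 2 <= r by rewrite expr2 ler_piMr.
have r21 : r ^+ 2 <= 1 by apply: le_trans rr r1.
have h1 : nm (f0 * eg) <= nm f0 * rg * r ^+ 2 by rewrite nmM -mulrA ler_wpM2l.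
have h2 : nm (Lf * Lg) <= bf * bg * r ^+ 2.
  rewrite nmM; have := ler_pM (nm_ge0 _) (nm_ge0 _) lf lg.
  by rewrite mulrACA -expr2.
have h3 : nm (Lf * eg) <= bf * rg * r ^+ 2.
  rewrite nmM -mulrA; apply: ler_pM => //; rewrite ?nm_ge0 //.
  by apply: le_trans lf _; rewrite ler_piMr.
have h4 : nm (g0 + Lg + eg) <= nm g0 + bg + rg.
  apply: le_trans (nmD _ _) _; apply: lerD; last by apply: le_trans hg' _; rewrite ler_piMr.
  by apply: le_trans (nmD _ _) _; rewrite lerD2l; apply: le_trans lg _; rewrite ler_piMr.
have h5 : nm (ef * (g0 + Lg + eg)) <= rf * (nm g0 + bg + rg) * r ^+ 2.
  rewrite nmM mulrAC; apply: ler_pM => //; rewrite ?nm_ge0 //.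
have n1 := nmD (f0 * eg + Lf * Lg + Lf * eg) (ef * (g0 + Lg + eg)).
have n2 := nmD (f0 * eg + Lf * Lg) (Lf * eg); have n3 := nmD (f0 * eg) (Lf * Lg).
rewrite !(mulrDl _ _ (r ^+ 2)).
by move: h1 h2 h3 h5 n1 n2 n3; clear; lra.
Qed.

(** From [1 / (b + h) = 1 / b - h / b^2 + h^2 / (b^2 (b + h))]. With [B = |b|] the three bounds add
    up exactly to [1 / (B - d)], so products over many boxes stay sharp. *)
Lemma jet_inv_shift d x i (c : R[i]) : 0 <= d -> d < nm (x i + c) ->
  jet d x (fun y => (y i + c)^-1) (nm (x i + c) - d)^-1.
Proof.
move=> d0 db; set b := x i + c in db *; set B := nm b in db *.
have B0 : 0 < B by apply: le_lt_trans db.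
have Bd : 0 < B - d by rewrite subr_gt0.
have bn0 : b != 0 by apply: contraTneq B0 => b0; rewrite /B b0 nm0 ltxx.
exists b^-1, (fun j => if j == i then - b ^- 2 else 0), (d ^+ 2 / (B ^+ 2 * (B - d))); split.
- by rewrite divr_ge0 ?sqr_ge0 // mulr_ge0 ?sqr_ge0 ?ltW.
- rewrite (bigD1 i) //= eqxx big1 => [|j /negPf ->]; last by rewrite nm0.
  rewrite addr0 nmN !nmV nmX -/B le_eqVlt; apply/orP; left; apply/eqP.
  by field; rewrite ?gt_eqF // ?subr_gt0.
move=> y r /andP[r0 r1] yx; set h := y i - x i.
have hd : nm h <= d * r := yx i.
have hd' : nm h <= d by apply: le_trans hd _; rewrite ler_piMr.
have yb : y i + c = b + h by rewrite /b /h; ring.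
have bh : B - d <= nm (b + h).
  have := ler_nmB b (- h); rewrite nmN opprK -/B; lra.
have bh0 : b + h != 0.
  by apply: contraTneq bh => ->; rewrite nm0 -ltNge.
have -> : (y i + c)^-1 - b^-1 - lin_part x (fun j => if j == i then - b ^- 2 else 0) y
    = h ^+ 2 / (b ^+ 2 * (b + h)).
  rewrite yb /lin_part (bigD1 i) //= eqxx big1 => [|j /negPf ->]; last by rewrite mulr0.
  by rewrite addr0 -/h; field; rewrite bn0 bh0.
rewrite nmM nmV nmX [nm (b ^+ 2 * _)]nmM nmX -/B [leRHS]mulrAC -exprMn.
apply: ler_pM; rewrite ?exprn_ge0 ?nm_ge0 ?invr_ge0 ?mulr_ge0 ?exprn_ge0 ?nm_ge0 //.
  by rewrite ler_pXn2r // ?nnegrE ?nm_ge0 // mulr_ge0.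
rewrite lef_pV2 ?posrE ?mulr_gt0 ?exprn_gt0 //; last by apply: lt_le_trans bh.
by rewrite ler_wpM2l // sqr_ge0.
Qed.

Lemma jet_sum d x (I : Type) (r : seq I) (P : pred I) (f : I -> _) (M : I -> R) : 0 <= d ->
  (forall i, P i -> jet d x (f i) (M i)) ->
  jet d x (fun y => \sum_(i <- r | P i) f i y) (\sum_(i <- r | P i) M i).
Proof.
move=> d0 fM; elim: r => [|i r IH].
  rewrite big_nil -(nm0 R); apply: eq_jet (jet_cst d x 0) => y; by rewrite big_nil.
rewrite big_cons; case: ifP => Pi.
  apply: eq_jet (jetD d0 (fM i Pi) IH) => y; by rewrite big_cons Pi.
by apply: eq_jet IH => y; rewrite big_cons Pi.
Qed.

Lemma jet_prod d x (I : Type) (r : seq I) (P : pred I) (f : I -> _) (M : I -> R) : 0 <= d ->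
  (forall i, P i -> jet d x (f i) (M i)) ->
  jet d x (fun y => \prod_(i <- r | P i) f i y) (\prod_(i <- r | P i) M i).
Proof.
move=> d0 fM; elim: r => [|i r IH].
  rewrite big_nil -(nm1 R); apply: eq_jet (jet_cst d x 1) => y; by rewrite big_nil.
rewrite big_cons; case: ifP => Pi.
  apply: eq_jet (jetM d0 (fM i Pi) IH) => y; by rewrite big_cons Pi.
by apply: eq_jet IH => y; rewrite big_cons Pi.
Qed.

(** Constants, linear coefficients and remainders are summed separately; each is majorized by the
    same geometric series, up to the factor [1 / d] for the linear ones. *)
Lemma jet_series d x (g : nat -> _) f A s : 0 < d -> 0 <= s < 1 ->
  (forall m, jet d x (g m) (A * s ^+ m)) ->
  (forall y, (forall i, nm (y i - x i) <= d) -> csums (fun m => g m y) (f y)) ->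
  exists M, jet d x f M.
Proof.
move=> d0 s01 gA gf; have dW := ltW d0.
have [g0 /choice [g1 /choice [rho gP]]] := choice gA.
have As m : 0 <= A * s ^+ m := jet_ge0 dW (gA m).
have part m : [/\ nm (g0 m) <= A * s ^+ m, forall i, nm (g1 m i) <= A / d * s ^+ m &
                 rho m <= A * s ^+ m].
  have [r0 le _] := gP m;
  have S0 : 0 <= \sum_i nm (g1 m i) by apply: sumr_ge0 => i _; apply: nm_ge0.
  have dS : 0 <= d * \sum_i nm (g1 m i) by rewrite mulr_ge0.
  have n0 := nm_ge0 (g0 m); split; [lra| |lra] => i.
  rewrite mulrAC ler_pdivlMr // mulrC; apply: le_trans (_ : d * (\sum_i nm (g1 m i)) <= _); last by lra.
  rewrite ler_wpM2l // (bigD1 i) //= lerDl; apply: sumr_ge0 => j _; exact: nm_ge0.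
have [F0 hF0] := csums_exists s01 (fun m => let: And3 h _ _ := part m in h).
have /choice[F1 hF1] : forall i, exists S, csums (fun m => g1 m i) S.
  by move=> i; apply: (csums_exists (A := A / d) s01) => m; have [_ h _] := part m.
pose B := A / (1 - s).
have A0 : 0 <= A by have := As 0%N; rewrite mulr1.
have B0 : 0 <= B by rewrite divr_ge0 // subr_ge0; case/andP: s01 => _ /ltW.
exists (nm F0 + d * (\sum_i nm (F1 i)) + B), F0, F1, B; split=> // y r r01 yx.
case/andP: (r01) => r0 r1.
have yd i : nm (y i - x i) <= d by apply: le_trans (yx i) _; rewrite ler_piMr.
have cs : csums (fun m => g m y - g0 m - lin_part x (g1 m) y) (f y - F0 - lin_part x F1 y).
  have c1 := csumsD (gf y yd) (csumsZ (-1) hF0).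
  have c2 : csums (fun m => lin_part x (g1 m) y) (lin_part x F1 y).
    by apply: csums_sum => i; apply: csumsZ.
  have := csumsD c1 (csumsZ (-1) c2); rewrite !mulN1r.
  by apply: eq_csums => m; rewrite !mulN1r.
rewrite mulrAC; apply: (csums_le s01 _ cs) => m; have [_ _ rA] := part m.
have [rho0 _ h] := gP m; apply: le_trans (h y r r01 yx) _.
by rewrite mulrAC ler_wpM2r // sqr_ge0.
Qed.

Lemma jet_holo_on (U : set ('I_N -> R[i])) f :
  (forall x, U x -> exists d M, 0 < d /\ jet d x f M) -> holo_on U f.
Proof.
move=> fj.
have quad x : U x -> exists d B F1, [/\ 0 < d, 0 <= B &
    forall y r, 0 <= r <= 1 -> (forall i, nm (y i - x i) <= d * r) ->
      nm (f y - f x - lin_part x F1 y) <= B * r ^+ 2].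
  move=> /fj[d [M [d0 [f0 [f1 [rho [rho0 le h]]]]]]]; exists d, rho, f1; split=> //.
  (* The estimate at [y = x] with [r = 0] forces the constant term to be [f x]. *)
  suff -> : f x = f0 by [].
  have := h x 0 (introT andP (conj (lexx _) ler01)).
  rewrite expr0n /= !mulr0 => /(_ _)/wrap[i|]; first by rewrite subrr nm0.
  rewrite /lin_part big1 => [|i _]; last by rewrite subrr mul0r.
  rewrite subr0 => le0; apply/eqP; rewrite -subr_eq0; apply/negPn/negP => /nm_gt0.
  by rewrite ltNge le0.
split=> x /quad[d [B [F1 [d0 B0 h]]]].
  move=> e e0; pose S := d * (\sum_i nm (F1 i)).
  have S0 : 0 <= S by rewrite mulr_ge0 ?(ltW d0) // sumr_ge0 // => i _; apply: nm_ge0.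
  (* Since [r <= 1], the increment is at most [B r^2 + S r <= (B + S) r], which is below
     [(B + S + 1) r <= e]. *)
  pose r := Num.min 1 (e / (B + S + 1)).
  have BS : 0 < B + S + 1 by rewrite ltr_wpDl // addr_ge0.
  have r0 : 0 < r by rewrite lt_min ltr01 divr_gt0.
  have r1 : r <= 1 by rewrite ge_min lexx.
  have re : r * (B + S + 1) <= e by rewrite -ler_pdivlMr // ge_min lexx orbT.
  exists (d * r); first by rewrite mulr_gt0.
  move=> y _ yx; have yx' i : nm (y i - x i) <= d * r by apply: ltW.
  have h1 := h y r (introT andP (conj (ltW r0) r1)) yx'.
  have h2 := lin_part_le F1 (ltW d0) yx'; rewrite -/S in h2.
  have h3 : B * r ^+ 2 <= B * r by rewrite ler_wpM2l // expr2 ler_piMr // ltW.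
  have -> : f y - f x = (f y - f x - lin_part x F1 y) + lin_part x F1 y by ring.
  apply: le_lt_trans (nmD _ _) _; lra.
move=> i; apply/cvg_ex; exists (F1 i : R[i]^o); apply/cvgrPdist_le => -[e e'] /=.
rewrite ltcE /= => /andP[/eqP -> {e'} e0].
(* The expansion is used with [r = |u| / d]. The difference quotient then deviates by at most
   [B |u| / d^2], and this choice keeps it below [e]. *)
pose t0 : R := Num.min d (e * d ^+ 2 / (B + 1)).
have B1 : 0 < B + 1 by rewrite ltr_wpDl.
have t00 : 0 < t0 by rewrite lt_min d0 divr_gt0 // mulr_gt0 // exprn_gt0.
have tC : (0 : R[i]) < t0%:C%C by rewrite ltcR.
near=> u; have u0 : (u : R[i]) != 0 by near: u; exact: (@nbhs_dnbhs_neq R[i]^o 0).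
have ut : nm u < t0.
  rewrite -ltcR -nm_normr; near: u.
  exact: (@pseudometric_normed_Zmodule.dnbhs0_lt _ R[i]^o _ tC).
have nu := nm_gt0 u0.
pose y l := if l == i then u + x i else x l.
have yxi : y i - x i = u by rewrite /y eqxx; ring.
have ud : nm u / d <= 1.
  by rewrite ler_pdivrMr // mul1r; apply: ltW; apply: lt_le_trans ut _; rewrite ge_min lexx.
have := h y (nm u / d); rewrite divr_ge0 ?nm_ge0 ?(ltW d0) // ud => /(_ isT)/(_ _)/wrap[j|].
  rewrite mulrC divfK ?gt_eqF // /y; case: eqVneq => [->|_]; last by rewrite subrr nm0 nm_ge0.
  by rewrite addrK.
have -> : lin_part x F1 y = u * F1 i.
  rewrite /lin_part (bigD1 i) //= yxi big1 ?addr0 // => j /negPf ji.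
  by rewrite /y ji subrr mul0r.
have -> : f y = f (fun l => if l == i then u *: (1 : R[i]^o) + x i else x l).
  by congr f; apply/funext => l; rewrite /y /GRing.scale /= mulr1.
have -> : f x = f (fun l => if l == i then x i else x l).
  by congr f; apply/funext => l; case: eqVneq => [->|].
set D := f _ - f _ => hD; clearbody D.
rewrite nm_normr lecR /GRing.scale /=.
have -> : F1 i - u^-1 * D = - (u^-1 * (D - u * F1 i)).
  by rewrite mulrBr mulKf // opprB.
rewrite nmN nmM nmV mulrC ler_pdivrMr //; apply: le_trans hD _.
have uB : nm u * (B + 1) <= e * d ^+ 2.
  rewrite -ler_pdivlMr //; apply: ltW; apply: lt_le_trans ut _.
  by rewrite ge_min lexx orbT.
have -> : B * (nm u / d) ^+ 2 = (B * nm u / d ^+ 2) * nm u by field; rewrite gt_eqF.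
rewrite ler_wpM2r ?nm_ge0 // ler_pdivrMr ?exprn_gt0 //; move: uB nu; clear; lra.
Unshelve. all: by end_near.
Qed.

End Jets.

(** * Growth of products and comparison of powers *)

Section RealBounds.
Variable R : realType.
Implicit Types (u v : nat -> R) (rho c d t : R).
Local Notation nm := (@Normc.normc R).

(** The finitely many exceptional factors are absorbed by the product of [max 1 (u l / v l)] over
    [l < L]. *)
Lemma prod_eventually_le u v : (forall l, 0 <= u l) -> (forall l, 0 < v l) ->
  (exists L, forall l, (L <= l)%N -> u l <= v l) ->
  exists c, 1 <= c /\ forall m, \prod_(l < m) u l <= c * \prod_(l < m) v l.
Proof.
move=> u0 v0 [L uv]; pose w l := Num.max 1 (u l / v l).
have w1 l : 1 <= w l by rewrite le_max lexx.
have w0 l : 0 <= w l by apply: le_trans (w1 l).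
have uw l : u l <= w l * v l by rewrite -ler_pdivrMr // le_max lexx orbT.
have pv0 m : 0 <= \prod_(l < m) v l by apply: prodr_ge0 => l _; apply: ltW.
have pw0 m : 0 <= \prod_(l < m) w l by apply: prodr_ge0 => l _.
have pw1 m : 1 <= \prod_(l < m) w l.
  by elim: m => [|m IH]; rewrite ?big_ord0 // big_ord_recr /= mulr_ege1.
exists (\prod_(l < L) w l); split=> // m.
have small m' : \prod_(l < m') u l <= (\prod_(l < m') w l) * \prod_(l < m') v l.
  by rewrite -big_split /=; apply: ler_prod => l _; rewrite u0 uw.
have [mL|/ltnW Lm] := leqP m L.
  apply: le_trans (small m) _; rewrite ler_wpM2r // -(subnKC mL).
  elim: (L - m)%N => [|e IH]; first by rewrite addn0.
  by apply: le_trans IH _; rewrite addnS big_ord_recr /=; apply: ler_peMr (pw0 _) (w1 _).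
rewrite -(subnKC Lm); elim: (m - L)%N => [|e IH]; first by rewrite addn0 small.
rewrite addnS !big_ord_recr /= mulrA; apply: ler_pM => //.
  by apply: prodr_ge0 => l _.
by apply: uv; rewrite leq_addr.
Qed.

Lemma bernoulli_le t m : 0 <= t <= 1 -> 1 - m%:R * t <= (1 - t) ^+ m.
Proof.
move=> /andP[t0 t1]; elim: m => [|m IH]; first by rewrite mul0r subr0 expr0.
have h : 0 <= 1 - t by rewrite subr_ge0.
rewrite exprS; apply: le_trans (ler_wpM2l h IH); rewrite -natr1.
have : 0 <= m%:R * t * t by rewrite !mulr_ge0.
lra.
Qed.

(** Take the inverse of [1 - s] with [s = (1 - 1 / rho) / (m + 1)]; Bernoulli's inequality gives
    [(1 - s)^m >= 1 - m s >= 1 / rho]. *)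
Lemma root_above_one rho m : 1 < rho -> exists t, 1 < t /\ t ^+ m <= rho.
Proof.
move=> r1; have r0 : 0 < rho by apply: lt_trans r1.
have ri1 : rho^-1 < 1 by rewrite invf_lt1.
have ri0 : 0 < rho^-1 by rewrite invr_gt0.
pose t := (1 - rho^-1) / m.+1%:R.
have m0 : 0 < m.+1%:R :> R by rewrite ltr0n.
have t0 : 0 < t by rewrite divr_gt0 // subr_gt0.
have tm : m.+1%:R * t = 1 - rho^-1 by rewrite /t mulrC divfK // gt_eqF.
have t1 : t < 1.
  apply: le_lt_trans (_ : m.+1%:R * t < 1); last by rewrite tm; lra.
  by apply: ler_peMl (ltW t0) _; rewrite ler1n.
exists (1 - t)^-1; have t1' : 0 < 1 - t by rewrite subr_gt0.
split; first by rewrite invf_gt1 //; lra.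
rewrite exprVn -[rho]invrK lef_pV2 ?posrE ?exprn_gt0 //.
apply: le_trans (bernoulli_le m _); last by rewrite !ltW.
have : m%:R * t <= m.+1%:R * t by rewrite ler_wpM2r ?ltW // ltr_nat.
rewrite tm; lra.
Qed.

Lemma nat_above c : exists L : nat, forall l, (L <= l)%N -> c <= l%:R.
Proof.
exists (Num.bound c) => l Ll.
apply: le_trans (ler_norm c) _; apply: ltW; apply: lt_le_trans (archi_boundP (normr_ge0 c)) _.
by rewrite ler_nat (leq_trans _ Ll) //; rewrite /Num.bound normr_id.
Qed.

(** If [p <= q], then [c + l <= 2 (l - c)] eventually, and [rho (l + 1)] outgrows [2 ^ p] however
    small [rho] is. If [p = q + 1], then [c + l <= t (l - c)] eventually, with [t > 1] and
    [t ^ (q + 1) <= rho]; the surplus factor [l - c] is at most [l + 1]. *)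
Lemma pow_ratio_eventually (p q : nat) c d rho : 0 <= c ->
  ((p <= q)%N /\ 0 < rho) \/ (p = q.+1 /\ 1 < rho) ->
  exists L, forall l : nat, (L <= l)%N ->
    d <= l%:R - c /\ (c + l%:R) ^+ p <= rho * (l%:R + 1) * (l%:R - c) ^+ q.
Proof.
move=> c0 [[pq rho0]|[-> rho1]].
  have [L hL] := nat_above (d + 4 * c + 2 + 2 ^+ p / rho + `|d|); exists L => l /hL h.
  have pr : 0 <= 2 ^+ p / rho :> R by rewrite divr_ge0 ?exprn_ge0 // ltW.
  have dn := ler_norm d; have dn' := ler_norm (- d); rewrite normrN in dn'.
  have x1 : 1 <= l%:R - c by lra.
  split; first by lra.
  apply: le_trans (_ : (2 * (l%:R - c)) ^+ p <= _).
    by apply: lerXn2r; rewrite ?nnegrE; lra.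
  rewrite exprMn; apply: ler_pM; rewrite ?exprn_ge0 //; first by lra.
    by rewrite mulrC -ler_pdivrMr //; lra.
  by rewrite ler_weXn2l.
have [t [t1 tr]] := root_above_one q.+1 rho1.
have [L hL] := nat_above (d + `|d| + c + c * (t + 1) / (t - 1)); exists L => l /hL h.
have dn := ler_norm d; have dn' := ler_norm (- d); rewrite normrN in dn'.
have t10 : 0 < t - 1 by rewrite subr_gt0.
have ct : 0 <= c * (t + 1) / (t - 1) by rewrite divr_ge0 ?mulr_ge0 ?(ltW t10) //; lra.
have x0 : 0 <= l%:R - c by lra.
have lt1 : c + l%:R <= t * (l%:R - c).
  have : c * (t + 1) / (t - 1) <= l%:R by lra.
  by rewrite ler_pdivrMr //; lra.
split; first by lra.
apply: le_trans (_ : (t * (l%:R - c)) ^+ q.+1 <= _).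
  by rewrite ler_pXn2r ?nnegrE ?mulr_ge0 //; lra.
rewrite exprMn exprS [(l%:R - c) ^+ q.+1]exprS mulrA; apply: ler_wpM2r; first by rewrite exprn_ge0.
by rewrite -exprS; apply: ler_pM; rewrite ?exprn_ge0 //; lra.
Qed.

(** The moduli tend to infinity with [l], so only finitely many can be small. *)
Lemma dist_nat_gt0 (b : R[i]) : (forall l : nat, b + l%:R != 0) ->
  exists d, 0 < d /\ forall l : nat, d <= nm (b + l%:R).
Proof.
move=> b0; have [L hL] := nat_above (nm b + 1).
exists (\big[Num.min/1]_(l < L) nm (b + l%:R)); split.
  by apply: lt_bigmin => // l _; apply: nm_gt0.
move=> l; have [lL|Ll] := ltnP l L.
  exact: (@bigmin_le_cond _ _ _ _ (Ordinal lL) xpredT (fun l : 'I_L => nm (b + l%:R))).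
apply: (le_trans (bigmin_le_id _ _ _ _)).
have := ler_nmB (l%:R) (- b); rewrite nmN opprK nm_nat [_ + b]addrC; have := hL l Ll; lra.
Qed.

End RealBounds.

(** * Uniform bounds for quotients of Pochhammer symbols *)

Section ParameterJets.
Variables (R : realType) (n p q : nat) (k : R).
Hypothesis k0 : 0 <= k.
Local Notation C := (R[i]).
Local Notation kC := (real_complex R k).
Local Notation nm := (@Normc.normc R).

(** The product of the factorials of the parts, kept as a product over boxes for a factorwise
    comparison. *)
Definition box_weight (lam : mpoly.multinom n) : R :=
  \prod_j \prod_(l < lam j) (l%:R + 1).

Lemma box_weight_ge0 lam : 0 <= box_weight lam.
Proof. by apply: prodr_ge0 => j _; apply: prodr_ge0 => l _; rewrite addr_ge0. Qed.

Lemma family_dist_gt0 (x : 'I_q -> C) :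
  (forall i (j : 'I_n) (l : nat), x i <> kC * j%:R - l%:R) ->
  exists d, 0 < d /\ forall i (j : 'I_n) (l : nat), d <= nm (x i + (- kC * j%:R + l%:R)).
Proof.
move=> hx.
have /choice[dd ddP] : forall ij : 'I_q * 'I_n, exists d, 0 < d /\
    forall l : nat, d <= nm (x ij.1 - kC * ij.2%:R + l%:R).
  move=> [i j]; apply: dist_nat_gt0 => l /=; apply/eqP => e; apply: (hx i j l).
  by apply/eqP; rewrite -subr_eq0 -e; apply/eqP; ring.
exists (\big[Num.min/1]_ij dd ij); split.
  by apply: lt_bigmin => // ij _; case: (ddP ij).
move=> i j l; apply: le_trans (@bigmin_le_cond _ _ _ _ (i, j) xpredT dd isT) _.
by have [_ /(_ l)] := ddP (i, j); rewrite /= addrA mulNr.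
Qed.

(** One radius and one constant serve all partitions. The quotient is regrouped by boxes; box
    [(j, l)] has a jet bound [u l] independent of the row, and each of the [n] rows costs one factor
    [A] in the comparison with [rho (l + 1)]. *)
Lemma gpochs_ratio_jet (x : 'I_(p + q) -> C) (rho : R) :
  (forall (i : 'I_q) (j : 'I_n) (l : nat), vright x i <> kC * j%:R - l%:R) ->
  ((p <= q)%N /\ 0 < rho) \/ (p = q.+1 /\ 1 < rho) ->
  exists d A, [/\ 0 < d, 0 <= A & forall lam : mpoly.multinom n,
    jet d x (fun v => gpochs k (vleft v) lam / gpochs k (vright v) lam)
      (A * (rho ^+ mpoly.mdeg lam * box_weight lam))].
Proof.
move=> hx hpq; have rho0 : 0 < rho by case: hpq => -[_ //]; apply: lt_trans.
have [d1 [d10 hd1]] := family_dist_gt0 hx.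
(* Half the distance to the poles, so that every denominator keeps modulus at least [d] on the
   polydisc. *)
pose d := Num.min 1 (d1 / 2).
have d0 : 0 < d by rewrite lt_min ltr01 divr_gt0.
have dle1 : d <= 1 by rewrite ge_min lexx.
have dle2 : d <= d1 / 2 by rewrite ge_min lexx orbT.
pose c := \sum_i nm (x i) + k * n%:R + 1.
have xc i (j : 'I_n) : nm (x i) + k * j%:R + d <= c.
  have h1 : nm (x i) <= \sum_i nm (x i).
    by rewrite (bigD1 i) //= lerDl; apply: sumr_ge0 => a _; apply: nm_ge0.
  have h2 : k * j%:R <= k * n%:R by rewrite ler_wpM2l // ler_nat ltnW.
  by rewrite /c; lra.
have c0 : 0 <= c.
  rewrite /c !addr_ge0 ?mulr_ge0 //; apply: sumr_ge0 => i _; exact: nm_ge0.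
(* [D l] bounds the inverse of one denominator factor: by [1 / d] near the poles and by
   [1 / (l - c)] for large [l]. *)
pose D (l : nat) := (Num.max d (l%:R - c))^-1.
have mx0 (l : nat) : 0 < Num.max d (l%:R - c) by rewrite lt_max d0.
have D0 l : 0 < D l by rewrite invr_gt0.
pose u (l : nat) := (c + l%:R) ^+ p * D l ^+ q.
have u0 l : 0 <= u l by apply: mulr_ge0; apply: exprn_ge0; [exact: addr_ge0|exact: ltW].
have [L hL] := pow_ratio_eventually d c0 hpq.
have [A [A1 hA]] : exists A, 1 <= A /\ forall m, \prod_(l < m) u l <= A * \prod_(l < m) (rho * (l%:R + 1)).
  apply: (prod_eventually_le (v := fun l : nat => rho * (l%:R + 1))) => [//|l|].
  - by rewrite mulr_gt0 // ltr_wpDl.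
  - exists L => l /hL[dl le]; rewrite /u /D.
    have -> : Num.max d (l%:R - c) = l%:R - c by apply/max_idPr.
    rewrite exprVn ler_pdivrMr ?exprn_gt0 //; exact: lt_le_trans dl.
exists d, (A ^+ n); split=> [//||lam]; first by rewrite exprn_ge0 // (le_trans ler01).
pose F (j : 'I_n) (l : nat) (v : 'I_(p + q) -> C) : C :=
  (\prod_i (vleft v i + (- kC * j%:R + l%:R))) *
  \prod_i (vright v i + (- kC * j%:R + l%:R))^-1.
apply: (@eq_jet _ _ _ _ (fun v => \prod_j \prod_(l < lam j) F j l v)).
  move=> v; rewrite /gpochs /gpoch /poch.
  rewrite [\prod_(i < p) _]exchange_big [\prod_(i < q) _]exchange_big /= -prodfV -big_split /=.
  apply: eq_bigr => j _; rewrite [\prod_(i < p) _]exchange_big [\prod_(i < q) _]exchange_big /=.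
  rewrite -prodfV -big_split /=.
  apply: eq_bigr => l _; rewrite /F -prodfV.
  by congr (_ * _); apply: eq_bigr => i _; rewrite mulNr addrA.
have nkl (j : 'I_n) (l : nat) : nm (- kC * j%:R + l%:R) <= k * j%:R + l%:R.
  by apply: le_trans (nmD _ _) _; rewrite nmM nmN nm_real !nm_nat ger0_norm.
have FM (j : 'I_n) (l : nat) : jet d x (F j l) (u l).
  apply: jetM (ltW d0) _ _.
    have -> : (c + l%:R) ^+ p = \prod_(i < p) (c + l%:R) by rewrite prodr_const card_ord.
    apply: jet_prod (ltW d0) _ => i _.
    apply: jet_le (jetD (ltW d0) (jet_coord d x (lshift q i)) (jet_cst d x _)).
    have := xc (lshift q i) j; have := nkl j l; lra.
  have -> : D l ^+ q = \prod_(i < q) D l by rewrite prodr_const card_ord.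
  apply: jet_prod (ltW d0) _ => i _.
  have := hd1 i j l; rewrite /vright; set z := x _ + _ => hz.
  have dz : d < nm z by lra.
  apply: jet_le (jet_inv_shift (ltW d0) dz).
  rewrite lef_pV2 ?posrE ?subr_gt0 // ge_max; apply/andP; split; first by lra.
  have := ler_nmB (l%:R) (- (x (rshift p i) - kC * j%:R)).
  have -> : l%:R - - (x (rshift p i) - kC * j%:R) = z by rewrite /z; ring.
  have := nmD (x (rshift p i)) (- (kC * j%:R)); rewrite !nmN nmM nm_real !nm_nat ger0_norm //.
  have := xc (rshift p i) j; lra.
have FMj (j : 'I_n) : jet d x (fun v => \prod_(l < lam j) F j l v) (\prod_(l < lam j) u l).
  by apply: jet_prod => [|l _]; [exact: ltW|exact: FM].
apply: (jet_le (M := \prod_j \prod_(l < lam j) u l)); last first.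
  by apply: jet_prod => [|j _]; [exact: ltW|exact: FMj].
apply: (le_trans (y := \prod_j (A * \prod_(l < lam j) (rho * (l%:R + 1))))).
  apply: ler_prod => j _; rewrite hA andbT; exact: prodr_ge0.
rewrite big_split /= prodr_const card_ord; apply: ler_wpM2l; first by rewrite exprn_ge0 // (le_trans ler01).
rewrite le_eqVlt; apply/orP; left; apply/eqP.
rewrite mpoly.mdegE -prodrXr -big_split /=; apply: eq_bigr => j _.
by rewrite big_split /= prodr_const card_ord.
Qed.

End ParameterJets.

Section PolynomialJets.
Variables (R : realType) (N n : nat).
Local Notation C := (R[i]).
Local Notation nm := (@Normc.normc R).

Lemma jet_exp d (x : 'I_N -> C) f M e : 0 <= d -> jet d x f M -> jet d x (fun y => f y ^+ e) (M ^+ e).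
Proof.
move=> d0 fM; elim: e => [|e IH].
  by rewrite expr0 -(nm1 R); apply: eq_jet (jet_cst d x 1) => y; rewrite expr0.
by rewrite exprS; apply: eq_jet (jetM d0 fM IH) => y; rewrite exprS.
Qed.

Lemma nonneg_nm (z : C) : 0 <= z -> z = (nm z)%:C%C.
Proof. by move=> z0; rewrite -nm_normr ger0_norm. Qed.

(** Jet bounds are computed monomial by monomial. As the coefficients are nonnegative, their moduli
    add up to the value at [(1, .., 1)]. *)
Lemma meval_jet d (x : 'I_N -> C) (phi : 'I_n -> 'I_N) m (f : mpoly.mpoly n C) b :
  0 <= d -> 0 <= b -> (forall i, nm (x (phi i)) + d <= b) -> nonneg_homog m f ->
  jet d x (fun y => mpoly.meval (fun i => y (phi i)) f) (nm (mpoly.meval (fun=> 1) f) * b ^+ m).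
Proof.
move=> d0 b0 xb [f0 fm].
have -> : nm (mpoly.meval (fun=> 1) f) * b ^+ m
    = \sum_(mu <- mpoly.msupp f) nm (mpoly.mcoeff mu f) * b ^+ m.
  rewrite -mulr_suml; congr (_ * _); rewrite mpoly.mevalE.
  have -> : \sum_(mu <- mpoly.msupp f) mpoly.mcoeff mu f * \prod_i 1 ^+ mu i
      = (\sum_(mu <- mpoly.msupp f) nm (mpoly.mcoeff mu f))%:C%C.
    rewrite rmorph_sum /=; apply: eq_bigr => mu _; rewrite -nonneg_nm //.
    by rewrite big1 ?mulr1 // => i _; rewrite expr1n.
  by rewrite nm_real ger0_norm //; apply: sumr_ge0 => mu _; apply: nm_ge0.
apply: (@eq_jet _ _ _ _ (fun y => \sum_(mu <- mpoly.msupp f) mpoly.mcoeff mu f * \prod_i y (phi i) ^+ mu i)).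
  by move=> y; rewrite mpoly.mevalE.
apply: jet_sum => // mu _.
have jp : jet d x (fun y => \prod_i y (phi i) ^+ mu i) (b ^+ mpoly.mdeg mu).
  rewrite mpoly.mdegE -prodrXr; apply: jet_prod => // i _.
  apply: jet_exp => //; exact: jet_le (xb i) (jet_coord d x (phi i)).
apply: jet_le (jetM d0 (jet_cst d x (mpoly.mcoeff mu f)) jp).
have [->//|/fm ->] := eqVneq (mpoly.mdeg mu) m.
by rewrite nm0 !mul0r.
Qed.

End PolynomialJets.

(** * Series over compositions, grouped by degree *)

Section JackSeries.
Variables (R : realType) (n : nat).
Local Notation C := (R[i]).
Local Notation nm := (@Normc.normc R).
Local Notation mnm := (mpoly.multinom n).

(** [bmultinom n M] holds the exponents of degree below [M], so a partial sum consists of complete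
    degree blocks. *)
Lemma psum_comps (t : mnm -> C) M : psum t M = \sum_(m < M) \sum_(eta <- comps n m) t eta.
Proof.
rewrite /psum (partition_big (fun e : mpoly.bmultinom n M => Ordinal (mpoly.bmdeg e)) xpredT) //=.
apply: eq_bigr => m _.
have -> : \sum_(eta <- comps n m) t eta
    = \sum_(eta <- [seq mpoly.bmnm e | e : mpoly.bmultinom n M <- enum {: mpoly.bmultinom n M} & mpoly.mdeg e == m]) t eta.
  apply: perm_big; apply: uniq_perm; rewrite ?comps_uniq //.
    rewrite map_inj_uniq ?filter_uniq -?enumT ?enum_uniq // => a b ab.
    by apply/eqP; rewrite mpoly.bmeqP; apply/eqP.
  move=> eta; rewrite mem_comps; apply/eqP/mapP => [em|[e]].
    have b : (mpoly.mdeg eta < M)%N by rewrite em.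
    by exists (mpoly.BMultinom b) => //; rewrite mem_filter mem_enum /= em eqxx.
  by rewrite mem_filter => /andP[/eqP em _] ->.
rewrite big_map big_filter big_enum_cond /=; apply: eq_bigl => e.
by rewrite -val_eqE.
Qed.

Lemma psum_cvg (t : mnm -> C) S : csums (fun m => \sum_(eta <- comps n m) t eta) S ->
  psum t @ \oo --> (S : C^o).
Proof.
move=> /csums_cvg h; have -> // : psum t = fun M => \sum_(m < M) \sum_(eta <- comps n m) t eta.
by apply/funext => M; rewrite psum_comps.
Qed.

Lemma abs_summable_of_bound (t : mnm -> C) A s : 0 <= s < 1 ->
  (forall m, \sum_(eta <- comps n m) nm (t eta) <= A * s ^+ m) -> abs_summable t.
Proof.
move=> s01 tA; have [S hS] : exists S, csums (fun m => \sum_(eta <- comps n m) `|t eta|) S.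
  apply: (csums_exists s01) => m; apply: le_trans (tA m).
  apply: le_trans (nm_sum _ _ _) _; apply: ler_sum => eta _.
  by rewrite nm_normr nm_real ger0_norm ?nm_ge0.
by apply/cvg_ex; exists S; apply: psum_cvg.
Qed.

Lemma series_val_csums (t : mnm -> C) A s : 0 <= s < 1 ->
  (forall m, \sum_(eta <- comps n m) nm (t eta) <= A * s ^+ m) ->
  csums (fun m => \sum_(eta <- comps n m) t eta) (series_val t).
Proof.
move=> s01 tA; have [S hS] : exists S, csums (fun m => \sum_(eta <- comps n m) t eta) S.
  by apply: (csums_exists s01) => m; apply: le_trans (nm_sum _ _ _) (tA m).
suff -> : series_val t = S by [].
exact: (cvg_lim (@norm_hausdorff _ C^o) (psum_cvg hS)).
Qed.

Lemma series_val_jet (N : nat) (t : ('I_N -> C) -> mnm -> C) x d (M : mnm -> R) A s :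
  0 < d -> 0 <= s < 1 -> (forall eta, jet d x (t^~ eta) (M eta)) ->
  (forall m, \sum_(eta <- comps n m) M eta <= A * s ^+ m) ->
  exists B, jet d x (fun y => series_val (t y)) B.
Proof.
move=> d0 s01 tM MA.
apply: (jet_series (g := fun m y => \sum_(eta <- comps n m) t y eta) d0 s01 (A := A)).
  by move=> m; apply: jet_le (MA m) _; apply: jet_sum (ltW d0) _ => eta _.
move=> y yx; apply: (series_val_csums s01 (A := A)) => m; apply: le_trans (MA m).
by apply: ler_sum => eta _; apply: jet_bound (ltW d0) (tM eta) y yx.
Qed.

(** Consecutive terms have the quotient [s (N + l) / (l + 1)], which tends to [s] and so eventually
    stays below the midpoint [t] of [s] and [1]. *)
Lemma rising_over_factorial (N s : R) : 0 <= N -> 0 <= s < 1 ->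
  exists A t, [/\ 0 <= A, 0 <= t < 1 & forall m, s ^+ m * (\prod_(l < m) (N + l%:R)) / m`!%:R <= A * t ^+ m].
Proof.
move=> N0 /andP[s0 s1]; pose t := (1 + s) / 2.
have t0 : 0 < t by rewrite divr_gt0 // ltr_wpDr.
have t1 : t < 1 by rewrite /t; lra.
have [A [A1 hA]] : exists A, 1 <= A /\ forall m,
    \prod_(l < m) (s * (N + l%:R) / l.+1%:R) <= A * \prod_(l < m) t.
  apply: (prod_eventually_le (u := fun l : nat => s * (N + l%:R) / l.+1%:R) (v := fun=> t)) => //.
    by move=> l; rewrite divr_ge0 // mulr_ge0 // addr_ge0.
  have [L hL] := nat_above (s * N / (t - s)).
  exists L => l /hL h; rewrite ler_pdivrMr ?ltr0n //.
  have ts : 0 < t - s by rewrite /t; lra.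
  by move: h; rewrite ler_pdivrMr // -natr1; lra.
exists A, t; split=> [||m]; [exact: le_trans A1|by rewrite (ltW t0) t1|].
have := hA m; rewrite prodr_const card_ord; congr (_ <= _).
rewrite !big_split /= prodr_const card_ord prodfV; congr (_ * _ / _).
by rewrite -natr_prod; congr (_%:R); rewrite fact_prod big_add1 big_mkord.
Qed.

End JackSeries.

(** * Majorants and holomorphy for both hypergeometric series *)

Section JackFamilies.
Variables (R : realType) (n : nat) (k : R).
Hypothesis k0 : 0 <= k.
Local Notation C := (R[i]).
Local Notation kC := (real_complex R k).
Local Notation nm := (@Normc.normc R).
Local Notation mnm := (mpoly.multinom n).
Local Notation P := (mpoly.mpoly n C).

(** The number [n a] for [a = k n + 1]. *)
Definition family_bound : R := n%:R * (k * n%:R + 1).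

(** What the estimates require of the polynomials, common to the nonsymmetric and the symmetric
    series. *)
Definition jack_family (G : mnm -> P) : Prop :=
  (forall eta, nonneg_homog (mpoly.mdeg eta) (G eta)) /\
  forall m, \sum_(eta <- comps n m) box_weight R (eplus eta) * nm (mpoly.meval (fun=> 1) (G eta))
    <= \prod_(l < m) (family_bound + l%:R).

Lemma family_bound_ge0 : 0 <= family_bound.
Proof. by rewrite mulr_ge0 // addr_ge0 // mulr_ge0. Qed.

Lemma meval1_ge0 m (f : P) : nonneg_homog m f -> 0 <= mpoly.meval (fun=> 1) f.
Proof.
move=> [f0 _]; rewrite mpoly.mevalE; apply: sumr_ge0 => mu _.
by rewrite mulr_ge0 // prodr_ge0 // => i _; rewrite expr1n.
Qed.

(** For a row [j < n] the factor [k n + 1 - k j + l] is at least [l + 1]. *)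
Lemma gpoch_box_weight (lam : mnm) :
  (box_weight R lam)%:C%C <= gpoch k (k * n%:R + 1)%:C%C lam.
Proof.
rewrite /box_weight /gpoch /poch rmorph_prod; apply: ler_prod => j _.
rewrite rmorph_prod /=; apply/andP; split.
  by apply: prodr_ge0 => l _; rewrite lecR addr_ge0.
apply: ler_prod => l _; rewrite lecR addr_ge0 //=.
have -> : (k * n%:R + 1)%:C%C - kC * j%:R + l%:R = (k * n%:R + 1 - k * j%:R + l%:R)%:C%C :> C.
  rewrite -[j%:R in LHS](rmorph_nat (real_complex R)) -[l%:R in LHS](rmorph_nat (real_complex R)).
  by rewrite -rmorphM -rmorphB -rmorphD.
rewrite lecR; have : k * j%:R <= k * n%:R by rewrite ler_wpM2l // ler_nat ltnW.
by lra.
Qed.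

Lemma Ljack_family : jack_family (Ljack (n := n) k).
Proof.
split=> [eta|m]; first exact: Ljack_nonneg_homog.
have prod0 : 0 <= \prod_(l < m) (family_bound + l%:R).
  by apply: prodr_ge0 => l _; rewrite addr_ge0 // family_bound_ge0.
have [L0|/(_ (k * n%:R + 1)%:C%C m) e] := Ljack_weighted_sum k0 n.
  by rewrite big1 // => eta _; rewrite L0 mpoly.meval0 nm0 mulr0.
rewrite -lecR; have -> : (\prod_(l < m) (family_bound + l%:R))%:C%C
    = \prod_(l < m) (n%:R * (k * n%:R + 1)%:C%C + l%:R) :> C.
  rewrite rmorph_prod; apply: eq_bigr => l _.
  by rewrite rmorphD /= rmorph_nat /family_bound rmorphM /= rmorph_nat.
rewrite -e rmorph_sum; apply: ler_sum => eta _; rewrite rmorphM /=.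
have L1 := meval1_ge0 (Ljack_nonneg_homog k0 eta).
by rewrite -(nonneg_nm L1) ler_wpM2r // gpoch_box_weight.
Qed.

Lemma eplus_idem (eta : mnm) : eplus (eplus eta) = eplus eta.
Proof.
rewrite /eplus; congr mpoly.Multinom; apply/val_inj => /=; apply: sorted_sort.
  by move=> a b c /= ab bc; apply: leq_trans bc ab.
by apply: sort_sorted => a b; apply: leq_total.
Qed.

(** Extension by zero, which turns the sum over partitions into a sum over all compositions of the
    shape used for [Ljack]. *)
Definition Cjack0 (lam : mnm) : P := if is_partition lam then Cjack k lam else 0.

Lemma Cjack_comps (lam : mnm) :
  Cjack k lam = \sum_(eta <- comps n (mpoly.mdeg lam) | eplus eta == lam) Ljack k eta.
Proof.
rewrite [RHS]big_mkcond /= -(big_comps _ (fun eta => if eplus eta == lam then Ljack k eta else 0)).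
rewrite /Cjack [LHS]big_mkcond [RHS]big_mkcond /=; apply: eq_bigr => e _.
case: ifPn => [/eqP el|_]; last by case: ifP.
by rewrite -(mdeg_eplus e) el eqxx.
Qed.

(** Each composition enters exactly one [Cjack lam], namely for [lam = eplus eta], and with the same
    weight; the bound for [Ljack] therefore carries over. *)
Lemma Cjack_family : jack_family Cjack0.
Proof.
have [Lh Ls] := Ljack_family; split=> [lam|m].
  rewrite /Cjack0; case: ifP => _; last exact: nonneg_homog0.
  rewrite Cjack_comps big_seq_cond.
  apply: (big_ind (fun f => nonneg_homog (mpoly.mdeg lam) f)) => [|f g|eta].
  - exact: nonneg_homog0.
  - exact: nonneg_homogD.
  - by rewrite mem_comps => /andP[/eqP <- _].
apply: le_trans (Ls m).
apply: (le_trans (y := \sum_(lam <- comps n m) \sum_(eta <- comps n m)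
    if is_partition lam && (eplus eta == lam)
    then box_weight R (eplus lam) * nm (mpoly.meval (fun=> 1) (Ljack k eta)) else 0)).
  rewrite big_seq [leRHS]big_seq; apply: ler_sum => lam; rewrite mem_comps => /eqP lm.
  rewrite /Cjack0; case: ifPn => part /=; last by rewrite mpoly.meval0 nm0 mulr0 big1.
  rewrite -big_mkcond -mulr_sumr ler_wpM2l ?box_weight_ge0 // Cjack_comps lm raddf_sum.
  exact: nm_sum.
rewrite exchange_big /= big_seq [leRHS]big_seq; apply: ler_sum => eta; rewrite mem_comps => em.
rewrite -big_mkcond (@big_seq_only _ _ _ _ _ (eplus eta)) ?comps_uniq //=.
- by rewrite eplus_idem.
- by rewrite mem_comps mdeg_eplus.
- by rewrite /is_partition eplus_idem !eqxx.
- by move=> lam _ /andP[_ /eqP].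
Qed.

Definition jterm (G : mnm -> P) p q (mu : 'I_p -> C) (nu : 'I_q -> C) (z w : 'I_n -> C) (eta : mnm) : C :=
  gpochs k mu (eplus eta) / gpochs k nu (eplus eta)
  * (mpoly.meval z (G eta) * mpoly.meval w (G eta))
  / ((mpoly.mdeg eta)`!%:R * mpoly.meval (@one_vec R n) (G eta)).

Lemma Fterm_jterm p q : @Fterm R n k p q = @jterm Cjack0 p q.
Proof.
apply/funext => mu; apply/funext => nu; apply/funext => z; apply/funext => w; apply/funext => lam.
rewrite /Fterm /jterm /Cjack0; case: ifPn => [/eqP ->//|_].
by rewrite !mpoly.meval0 !mulr0 mul0r.
Qed.

Variable G : mnm -> P.
Hypothesis GF : jack_family G.

Definition term_bound (A rho r : R) (eta : mnm) : R :=
  A * (rho ^+ mpoly.mdeg eta * box_weight R (eplus eta))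
  * (nm (mpoly.meval (fun=> 1) (G eta)) * r ^+ mpoly.mdeg eta / (mpoly.mdeg eta)`!%:R).

(** Summing over a whole degree turns the weights into the rising factorial of [jack_family], which
    grows too slowly against [m!] to spoil a geometric rate. *)
Lemma term_bound_sum A rho r : 0 <= A -> 0 <= rho * r < 1 ->
  exists B t, 0 <= t < 1 /\ forall m, \sum_(eta <- comps n m) term_bound A rho r eta <= B * t ^+ m.
Proof.
move=> A0 rr; have [_ Gs] := GF.
have [B [t [B0 t01 hB]]] := rising_over_factorial family_bound_ge0 rr.
exists (A * B), t; split=> // m; rewrite -mulrA; apply: le_trans (ler_wpM2l A0 (hB m)).
have -> : \sum_(eta <- comps n m) term_bound A rho r eta = A * ((rho * r) ^+ m / m`!%:R *
    \sum_(eta <- comps n m) box_weight R (eplus eta) * nm (mpoly.meval (fun=> 1) (G eta))).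
  rewrite !mulr_sumr; apply: eq_big_seq => eta; rewrite mem_comps /term_bound => /eqP ->.
  rewrite exprMn; ring.
rewrite ler_wpM2l // [leRHS]mulrAC ler_wpM2l // divr_ge0 // exprn_ge0 //.
by case/andP: rr.
Qed.

(* Where [G eta] vanishes at [(1, .., 1)] it vanishes identically, and the term is [0]. *)
Lemma quotient_le (x y c a b : R) (m : nat) : 0 <= c -> 0 <= x -> 0 <= y ->
  x <= c * a ^+ m -> y <= c * b ^+ m -> 
  x * y / (m`!%:R * c) <= c * (a * b) ^+ m / m`!%:R.
Proof.
move=> c0 x0 y0 xa yb; have f0 : 0 < m`!%:R :> R by rewrite ltr0n fact_gt0.
have [cz|cn] := eqVneq c 0; first by rewrite cz !mul0r mulr0 invr0 mulr0.
have cp : 0 < c by rewrite lt_neqAle eq_sym cn.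
have -> : c * (a * b) ^+ m / m`!%:R = (c * a ^+ m) * (c * b ^+ m) / (m`!%:R * c).
  by rewrite exprMn; field; rewrite cn gt_eqF.
by rewrite ler_wpM2r ?invr_ge0 ?mulr_ge0 ?(ltW f0) //; apply: ler_pM.
Qed.

Lemma meval_le m (f : P) (z : 'I_n -> C) b : 0 <= b -> (forall i, nm (z i) <= b) ->
  nonneg_homog m f -> nm (mpoly.meval z f) <= nm (mpoly.meval (fun=> 1) f) * b ^+ m.
Proof.
move=> b0 zb fm.
have zb' i : nm (z (id i)) + 0 <= b by rewrite addr0.
have := jet_bound (lexx 0) (meval_jet (lexx 0) b0 zb' fm) (y := z).
by apply=> i; rewrite subrr nm0.
Qed.

Section Exponents.
Variables (p q : nat) (rho : R).
Hypothesis hpq : ((p <= q)%N /\ 0 < rho) \/ (p = q.+1 /\ 1 < rho).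

Lemma jterm_param_jet (x : 'I_(p + q) -> C) (z w : 'I_n -> C) a b :
  (forall (i : 'I_q) (j : 'I_n) (l : nat), vright x i <> kC * j%:R - l%:R) ->
  0 <= a -> 0 <= b -> (forall i, nm (z i) <= a) -> (forall i, nm (w i) <= b) ->
  exists d A, [/\ 0 < d, 0 <= A & forall eta,
    jet d x (fun v => jterm G (vleft v) (vright v) z w eta) (term_bound A rho (a * b) eta)].
Proof.
move=> hx a0 b0 za wb; have [Gh _] := GF.
have [d [A [d0 A0 hA]]] := gpochs_ratio_jet k0 hx hpq.
exists d, A; split=> // eta; have dW := ltW d0.
set c := (mpoly.meval z (G eta) * mpoly.meval w (G eta))
  / ((mpoly.mdeg eta)`!%:R * mpoly.meval (@one_vec R n) (G eta)).
have jc := jetM dW (hA (eplus eta)) (jet_cst d x c).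
apply: (@eq_jet _ _ _ _ (fun v => gpochs k (vleft v) (eplus eta) / gpochs k (vright v) (eplus eta) * c)).
  by move=> v; rewrite /jterm /c mulrA.
apply: jet_le jc; rewrite mdeg_eplus /term_bound.
have rho0 : 0 <= rho by case: hpq => -[_ h]; apply: ltW => //; apply: lt_trans h.
apply: ler_wpM2l; first by rewrite mulr_ge0 // mulr_ge0 ?exprn_ge0 ?box_weight_ge0.
rewrite /c nmM nmM nmV nmM nm_nat; apply: quotient_le; rewrite ?nm_ge0 //.
- exact: meval_le.
- exact: meval_le.
Qed.

Lemma jterm_variable_jet (mu : 'I_p -> C) (nu : 'I_q -> C) (x : 'I_(n + n) -> C) d a b :
  (forall (i : 'I_q) (j : 'I_n) (l : nat), nu i <> kC * j%:R - l%:R) ->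
  0 <= d -> 0 <= a -> 0 <= b ->
  (forall i, nm (vleft x i) + d <= a) -> (forall i, nm (vright x i) + d <= b) ->
  exists A, 0 <= A /\ forall eta,
    jet d x (fun v => jterm G mu nu (vleft v) (vright v) eta) (term_bound A rho (a * b) eta).
Proof.
move=> hnu d0 a0 b0 xa xb; have [Gh _] := GF.
pose v0 (i : 'I_(p + q)) := match fintype.split i with inl i => mu i | inr i => nu i end.
have v0l : vleft v0 = mu.
  by apply/funext => i; rewrite /vleft /v0 (unsplitK (inl _ i)).
have v0r : vright v0 = nu.
  by apply/funext => i; rewrite /vright /v0 (unsplitK (inr _ i)).
have hv0 (i : 'I_q) (j : 'I_n) (l : nat) : vright v0 i <> kC * j%:R - l%:R by rewrite v0r.
(* The parameters are fixed here; the parameter jet, evaluated at its centre [(mu, nu)], bounds the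
   constant quotient. *)
have [d' [A [d'0 A0 hA]]] := gpochs_ratio_jet k0 hv0 hpq.
exists A; split=> // eta; set m := mpoly.mdeg eta.
have ratio : nm (gpochs k mu (eplus eta) / gpochs k nu (eplus eta))
    <= A * (rho ^+ m * box_weight R (eplus eta)).
  have := jet_bound (ltW d'0) (hA (eplus eta)) (y := v0); rewrite v0l v0r mdeg_eplus; apply=> i.
  by rewrite subrr nm0 ltW.
have jz := meval_jet (phi := fun i => lshift n i) d0 a0 xa (Gh eta).
have jw := meval_jet (phi := fun i => rshift n i) d0 b0 xb (Gh eta).
set c := ((m`!)%:R * mpoly.meval (@one_vec R n) (G eta))^-1.
have := jetM d0 (jetM d0 (jet_cst d x (gpochs k mu (eplus eta) / gpochs k nu (eplus eta)))
   (jetM d0 jz jw)) (jet_cst d x c).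
apply: jet_le; rewrite /term_bound -/m -mulrA.
apply: ler_pM; rewrite ?nm_ge0 // ?mulr_ge0 ?exprn_ge0 ?nm_ge0 //.
rewrite /c nmV nmM nm_nat; apply: quotient_le; rewrite ?nm_ge0 // ?mulr_ge0 ?exprn_ge0 ?nm_ge0 //.
Qed.

End Exponents.

(** For [p <= q] the value [1 / (r + 1)] works for every [r]. For [p = q + 1] the value
    [2 / (1 + r)] exceeds [1] exactly when [r < 1], and then [2 r / (1 + r) < 1]. *)
Lemma exponent_choice p q (r : R) : 0 <= r -> (p <= q)%N \/ (p = q.+1 /\ r < 1) ->
  exists rho, (((p <= q)%N /\ 0 < rho) \/ (p = q.+1 /\ 1 < rho)) /\ 0 <= rho * r < 1.
Proof.
move=> r0 [pq|[-> r1]].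
  have r1 : 0 < r + 1 by rewrite ltr_wpDl.
  exists (r + 1)^-1; split; first by left; rewrite invr_gt0.
  rewrite mulr_ge0 ?invr_ge0 ?(ltW r1) //= mulrC ltr_pdivrMr //; lra.
have r2 : 0 < 1 + r by rewrite ltr_wpDr.
exists (2 / (1 + r)); split; first by right; split=> //; rewrite ltr_pdivlMr //; lra.
rewrite mulr_ge0 ?divr_ge0 ?(ltW r2) //= mulrAC ltr_pdivrMr //; lra.
Qed.

Lemma le_supnorm N (z : 'I_N -> C) i : nm (z i) <= supnorm z.
Proof. exact: (@le_bigmax_cond _ _ _ _ i xpredT (fun i => nm (z i))). Qed.

Lemma supnorm_ge0 N (z : 'I_N -> C) : 0 <= supnorm z.
Proof. exact: bigmax_ge_id. Qed.

Lemma jterm_holo_param p q (z w : 'I_n -> C) :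
  (p <= q)%N \/ (p = q.+1 /\ supnorm z * supnorm w < 1) ->
  holo_on [set v : 'I_(p + q) -> C |
     forall (i : 'I_q) (j : 'I_n) (l : nat), vright v i <> kC * j%:R - l%:R]
    (fun v => series_val (jterm G (vleft v) (vright v) z w)).
Proof.
move=> h; have s0 := mulr_ge0 (supnorm_ge0 z) (supnorm_ge0 w).
have [rho [hpq rr]] := exponent_choice s0 h.
apply: jet_holo_on => x hx.
have [d [A [d0 A0 hA]]] := jterm_param_jet hpq hx (supnorm_ge0 z) (supnorm_ge0 w) (le_supnorm z) (le_supnorm w).
have [B [t [t01 hB]]] := term_bound_sum A0 rr.
have [M hM] := series_val_jet d0 t01 hA hB.
by exists d, M.
Qed.

(** With [d <= 1] the product grows by at most [d (a + b + 1)], and [d] is chosen so that this is at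
    most half of the gap [1 - a b]. *)
Lemma polydisc_radius (a b : R) : 0 <= a -> 0 <= b -> a * b < 1 ->
  exists d, 0 < d /\ (a + d) * (b + d) < 1.
Proof.
move=> a0 b0 ab; have ab2 : 0 < 2 * (a + b + 1) by rewrite mulr_gt0 // ltr_wpDl // addr_ge0.
exists (Num.min 1 ((1 - a * b) / (2 * (a + b + 1)))); split.
  by rewrite lt_min ltr01 divr_gt0 // subr_gt0.
set d := Num.min _ _; have d1 : d <= 1 by rewrite ge_min lexx.
have d2 : d * (2 * (a + b + 1)) <= 1 - a * b by rewrite -ler_pdivlMr // ge_min lexx orbT.
have d0 : 0 <= d by rewrite le_min ler01 divr_ge0 ?(ltW ab2) // subr_ge0 ltW.
have dd : d * d <= d by rewrite ler_piMr.
have -> : (a + d) * (b + d) = a * b + d * (a + b) + d * d by ring.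
lra.
Qed.

Lemma jterm_variable_bound p q (mu : 'I_p -> C) (nu : 'I_q -> C) (x : 'I_(n + n) -> C) :
  (forall (i : 'I_q) (j : 'I_n) (l : nat), nu i <> kC * j%:R - l%:R) ->
  (p <= q)%N \/ (p = q.+1 /\ supnorm (vleft x) * supnorm (vright x) < 1) ->
  exists d B t (M : mnm -> R), [/\ 0 < d, 0 <= t < 1,
    forall eta, jet d x (fun v => jterm G mu nu (vleft v) (vright v) eta) (M eta) &
    forall m, \sum_(eta <- comps n m) M eta <= B * t ^+ m].
Proof.
move=> hnu h; have s0 := supnorm_ge0 (vleft x); have s0' := supnorm_ge0 (vright x).
(* The radius is fixed before [rho], since [rho] has to fit the enlarged polydisc. *)
have [d [d0 hd]] : exists d, 0 < d /\ ((p <= q)%N \/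
    (p = q.+1 /\ (supnorm (vleft x) + d) * (supnorm (vright x) + d) < 1)).
  case: h => [pq|[pq lt1]]; first by exists 1; split=> //; left.
  by have [d [d0 dl]] := polydisc_radius s0 s0' lt1; exists d; split=> //; right.
have a0 := addr_ge0 s0 (ltW d0); have b0 := addr_ge0 s0' (ltW d0).
have [rho [hpq rr]] := exponent_choice (mulr_ge0 a0 b0) hd.
have xa i : nm (vleft x i) + d <= supnorm (vleft x) + d by rewrite lerD2r le_supnorm.
have xb i : nm (vright x i) + d <= supnorm (vright x) + d by rewrite lerD2r le_supnorm.
have [A [A0 hA]] := jterm_variable_jet hpq mu hnu (ltW d0) a0 b0 xa xb.
have [B [t [t01 hB]]] := term_bound_sum A0 rr.
by exists d, B, t, (term_bound A rho ((supnorm (vleft x) + d) * (supnorm (vright x) + d))).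
Qed.

Lemma jterm_holo_variables p q (mu : 'I_p -> C) (nu : 'I_q -> C) (U : set ('I_(n + n) -> C)) :
  (forall (i : 'I_q) (j : 'I_n) (l : nat), nu i <> kC * j%:R - l%:R) ->
  (forall x, U x -> (p <= q)%N \/ (p = q.+1 /\ supnorm (vleft x) * supnorm (vright x) < 1)) ->
  holo_on U (fun v => series_val (jterm G mu nu (vleft v) (vright v))).
Proof.
move=> hnu hU; apply: jet_holo_on => x /hU h.
have [d [B [t [M [d0 t01 hM hB]]]]] := jterm_variable_bound mu hnu h.
have [B' hB'] := series_val_jet d0 t01 hM hB.
by exists d, B'.
Qed.

Lemma jterm_abs_summable p q (mu : 'I_p -> C) (nu : 'I_q -> C) (z w : 'I_n -> C) :
  (forall (i : 'I_q) (j : 'I_n) (l : nat), nu i <> kC * j%:R - l%:R) ->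
  (p <= q)%N \/ (p = q.+1 /\ supnorm z * supnorm w < 1) ->
  abs_summable (jterm G mu nu z w).
Proof.
pose x (i : 'I_(n + n)) := match fintype.split i with inl i => z i | inr i => w i end.
have xl : vleft x = z by apply/funext => i; rewrite /vleft /x (unsplitK (inl _ i)).
have xr : vright x = w by apply/funext => i; rewrite /vright /x (unsplitK (inr _ i)).
rewrite -{1 2}xl -{1 2}xr => hnu h.
have [d [B [t [M [d0 t01 hM hB]]]]] := jterm_variable_bound mu hnu h.
apply: (abs_summable_of_bound t01) => m; apply: le_trans (hB m).
apply: ler_sum => eta _; apply: (jet_bound (ltW d0) (hM eta)) => i.
by rewrite subrr nm0 ltW.
Qed.

End JackFamilies.

Unset Implicit Arguments.

Theorem theorem6p4 (R : realType) (n : nat) (k : R) (hk : 0 <= k)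
    (p q : nat) (mu : 'I_p -> R[i]) (nu : 'I_q -> R[i])
    (hnu : forall (i : 'I_q) (j : 'I_n) (l : nat),
             nu i <> real_complex R k * j%:R - l%:R) :
  (* (1) p <= q : entire in (z, w) *)
  ((p <= q)%N ->
     (forall z w : 'I_n -> R[i],
        abs_summable (Kterm k mu nu z w) /\ abs_summable (Fterm k mu nu z w))
     /\ holo_on setT
          (fun v : 'I_(n + n) -> R[i] =>
             series_val (Kterm k mu nu (vleft v) (vright v)))
     /\ holo_on setT
          (fun v : 'I_(n + n) -> R[i] =>
             series_val (Fterm k mu nu (vleft v) (vright v))))
  (* (2) p = q + 1 : holomorphic on ||z||_oo ||w||_oo < 1 *)
  /\ (p = q.+1 ->
     (forall z w : 'I_n -> R[i], supnorm z * supnorm w < 1 ->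
        abs_summable (Kterm k mu nu z w) /\ abs_summable (Fterm k mu nu z w))
     /\ holo_on [set v : 'I_(n + n) -> R[i] |
                  supnorm (vleft v) * supnorm (vright v) < 1]
          (fun v => series_val (Kterm k mu nu (vleft v) (vright v)))
     /\ holo_on [set v : 'I_(n + n) -> R[i] |
                  supnorm (vleft v) * supnorm (vright v) < 1]
          (fun v => series_val (Fterm k mu nu (vleft v) (vright v))))
  (* holomorphy in the parameters (mu, nu) on the admissible parameter set,
     for every fixed (z, w) in the respective domain of convergence *)
  /\ (forall z w : 'I_n -> R[i],
        (p <= q)%N \/ (p = q.+1 /\ supnorm z * supnorm w < 1) ->
        holo_on [set v : 'I_(p + q) -> R[i] |
                  forall (i : 'I_q) (j : 'I_n) (l : nat),
                    vright v i <> real_complex R k * j%:R - l%:R]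
          (fun v => series_val (Kterm k (vleft v) (vright v) z w))
        /\ holo_on [set v : 'I_(p + q) -> R[i] |
                  forall (i : 'I_q) (j : 'I_n) (l : nat),
                    vright v i <> real_complex R k * j%:R - l%:R]
          (fun v => series_val (Fterm k (vleft v) (vright v) z w))).
Proof.
have Fj := Fterm_jterm n k.
have LF := Ljack_family n hk; have CF := Cjack_family n hk.
split=> [pq|]; [|split=> [pq|z w h]].
- split=> [z w|]; last split.
  + split; first by apply: (jterm_abs_summable hk LF) => //; left.
    by rewrite Fj; apply: (jterm_abs_summable hk CF) => //; left.
  + by apply: (jterm_holo_variables hk LF) => // x _; left.
  + by rewrite Fj; apply: (jterm_holo_variables hk CF) => // x _; left.
- split=> [z w zw|]; last split.
  + split; first by apply: (jterm_abs_summable hk LF) => //; right.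
    by rewrite Fj; apply: (jterm_abs_summable hk CF) => //; right.
  + by apply: (jterm_holo_variables hk LF) => // x ?; right.
  + by rewrite Fj; apply: (jterm_holo_variables hk CF) => // x ?; right.
- split; first exact: (jterm_holo_param hk LF).
  by rewrite Fj; apply: (jterm_holo_param hk CF).
Qed.
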